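(* Let $\lambda\in\mathbb R$ and $k\ge1$, and set $S=\{1,\dots,2k\}$. Let $\mathbf n_1$ be distributed according to $\mathbb P^S_{n,\lambda}$ and, independently, let $\mathbf n_2$ be distributed according to $\mathbb P^\emptyset_{n,\lambda}$. Let $Y^{\mathsf s}_{k,\lambda}$ (resp. $Y^{\mathsf d}_{k,\lambda}$) be the projection of $X^{\mathsf s}_{k,\lambda}$ (resp. $X^{\mathsf d}_{k,\lambda}$) on its first $2k$ coordinates. Then $Y^{\mathsf s}_{k,\lambda}$ and $Y^{\mathsf d}_{k,\lambda}$ have Gaussian tails and, as $n\to\infty$, $$\left(\frac{|\mathcal C_1(\mathbf n_1)|}{\sqrt n},\dots,\frac{|\mathcal C_{2k}(\mathbf n_1)|}{\sqrt n}\right)\longrightarrow Y^{\mathsf s}_{k,\lambda},\qquad \left(\frac{|\mathcal C_1(\mathbf n_1+\mathbf n_2)|}{\sqrt n},\dots,\frac{|\mathcal C_{2k}(\mathbf n_1+\mathbf n_2)|}{\sqrt n}\right)\longrightarrow Y^{\mathsf d}_{k,\lambda},$$ where both convergences are in distribution.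
   Context: For $n\ge1$ let $K_n$ be the complete graph on $V_n=\{1,\dots,n\}$, with edge set $\mathcal P_2(V_n)$ (the unordered pairs of distinct vertices). For $\lambda\in\mathbb R$ put $d_n(\lambda)=\frac1n\left(1-\frac{\lambda}{\sqrt n}\right)$; $n$ is taken large enough that $d_n(\lambda)>0$ and $S\subset V_n$. A current on $K_n$ is a function $\mathbf n:\mathcal P_2(V_n)\to\mathbb N=\{0,1,2,\dots\}$, written $\{i,j\}\mapsto\mathbf n_{i,j}$; $\Omega_n$ is the set of currents. Its source set is $\partial\mathbf n=\{x\in V_n:\sum_{y\ne x}\mathbf n_{x,y}\text{ is odd}\}$ and its weight is $w(\mathbf n)=\prod_{\{i,j\}\in\mathcal P_2(V_n)}\frac{d_n(\lambda)^{\mathbf n_{i,j}}}{\mathbf n_{i,j}!}$. For $S\subset V_n$ of even cardinality, $Z_n^S(\lambda)=\sum_{\mathbf n\in\Omega_n:\,\partial\mathbf n=S}w(\mathbf n)$, and $\mathbb P^S_{n,\lambda}$ is the probability measure on $\Omega_n$ given by $\mathbb P^S_{n,\lambda}[\mathbf n]=\frac{1}{Z^S_n(\lambda)}w(\mathbf n)\mathbf 1[\partial\mathbf n=S]$. Two vertices $x,y$ are connected in $\mathbf n$ if there is a path from $x$ to $y$ all of whose edges $e$ satisfy $\mathbf n_e>0$; $\mathcal C_x(\mathbf n)$ is the set of vertices connected to $x$ in $\mathbf n$ (including $x$). $\mathcal P_{\mathrm{even}}(S)$ is the set of partitions of $S$ all of whose blocks have even cardinality. For a current $\mathbf n$ with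 $\partial\mathbf n=S$, $\mathfrak P(\mathbf n)\in\mathcal P_{\mathrm{even}}(S)$ is the partition of $S$ in which two elements are in the same block iff they are connected in $\mathbf n$. $X^{\mathsf s}_{k,\lambda}$ and $X^{\mathsf d}_{k,\lambda}$ are the random variables on $(\mathbb R_{\ge0})^{2k}\times\mathcal P_{\mathrm{even}}(S)$ which are the limits in distribution as $n\to\infty$ (these limits exist) of $\left(\frac{|\mathcal C_1(\mathbf m)|}{\sqrt n},\dots,\frac{|\mathcal C_{2k}(\mathbf m)|}{\sqrt n},\mathfrak P(\mathbf m)\right)$ for $\mathbf m=\mathbf n_1$ and $\mathbf m=\mathbf n_1+\mathbf n_2$ respectively. A random variable $X$ on $\mathbb R^d$ has Gaussian tails if there is $c>0$ such that $\mathbb P[|X|\ge t]\le\frac1c e^{-ct^2}$ for all $t\ge1$, where $|\cdot|$ is the Euclidean norm. *)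

(* Defs.v *)
From HB Require Import structures.
From mathcomp Require Import all_boot all_order all_algebra.
From mathcomp Require Import all_classical all_reals all_analysis.

Set Implicit Arguments.
Unset Strict Implicit.
Unset Printing Implicit Defensive.
Set Warnings "-redundant-canonical-projection".

Import Order.TTheory GRing.Theory Num.Theory.
Import numFieldNormedType.Exports.

Local Open Scope classical_set_scope.
Local Open Scope ring_scope.

(* Vertices are numbered from 0: the vertex i of {1, ..., n} is the ordinal of
   'I_n with value i.-1. *)
Definition edge (n : nat) : Type := {e : {set 'I_n} | #|e| == 2%N}.
HB.instance Definition _ (n : nat) := Finite.on (edge n).

Definition current (n : nat) : Type := {ffun edge n -> nat}.
HB.instance Definition _ (n : nat) := Countable.on (current n).
HB.instance Definition _ (n : nat) :=
  isPointed.Build (current n) [ffun=> 0%N].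
HB.instance Definition _ (n : nat) :=
  @isMeasurable.Build default_measure_display (current n)
    discrete_measurable discrete_measurable0
    discrete_measurableC discrete_measurableU.

Definition addc (n : nat) (m1 m2 : current n) : current n :=
  [ffun e => (m1 e + m2 e)%N].

Definition sources (n : nat) (m : current n) : {set 'I_n} :=
  [set x : 'I_n | odd (\sum_(e : edge n | x \in val e) m e)].

Definition dn (R : realType) (n : nat) (lambda : R) : R :=
  n%:R^-1 * (1 - lambda / Num.sqrt n%:R).

Definition weight (R : realType) (n : nat) (lambda : R) (m : current n) : R :=
  \prod_(e : edge n) (dn n lambda ^+ m e / (m e)`!%:R).

Definition Zn (R : realType) (n : nat) (lambda : R) (S : {set 'I_n}) : \bar R :=
  \esum_(m in [set m : current n | sources m = S]) (weight lambda m)%:E.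

(* When dn n lambda > 0 and #|S| is even, Zn lambda S is positive and finite, so
   fine Zn is the partition function as a real number. *)
Definition current_prob (R : realType) (n : nat) (lambda : R) (S : {set 'I_n})
    (m : current n) : R :=
  if sources m == S then weight lambda m / fine (Zn lambda S) else 0.

Definition open_edge (n : nat) (m : current n) (x y : 'I_n) : bool :=
  [exists e : edge n, (val e == [set x; y]%SET) && (0 < m e)%N].

(* x and y are natural-number labels, so that the same labels 0, ..., 2k - 1
   denote vertices of K_n for every n >= 2k; a label outside V_n is connected
   to nothing. *)
Definition connected_in (n : nat) (m : current n) (x y : nat) : bool :=
  [exists i : 'I_n, exists j : 'I_n,
    [&& i == x :> nat, j == y :> nat & connect (open_edge m) i j]].

Definition ccluster (n : nat) (m : current n) (x : nat) : {set 'I_n} :=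
  [set y : 'I_n | connected_in m x y].

(* S = {1, ..., 2k} inside V_n; it has 2k elements only when 2k <= n. *)
Definition Sn (k n : nat) : {set 'I_n} := [set x : 'I_n | (x < k.*2)%N].

(* Sets of subsets of S, where S is identified with 'I_(2k), carrying the
   discrete topology. *)
Definition set_system_S (k : nat) : Type :=
  discrete_topology {set {set 'I_(k.*2)}}.
HB.instance Definition _ (k : nat) := DiscreteTopology.on (set_system_S k).
HB.instance Definition _ (k : nat) :=
  isPointed.Build (set_system_S k) (finset.set0 : {set {set 'I_(k.*2)}}).

Definition ambient (R : realType) (k : nat) : Type :=
  ('rV[R]_(k.*2) * set_system_S k)%type.
HB.instance Definition _ (R : realType) (k : nat) :=
  Topological.copy (ambient R k) ('rV[R]_(k.*2) * set_system_S k)%type.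
HB.instance Definition _ (R : realType) (k : nat) :=
  Pointed.copy (ambient R k) ('rV[R]_(k.*2) * set_system_S k)%type.

Definition even_partition (k : nat) (p : {set {set 'I_(k.*2)}}) : bool :=
  finset.partition p [set: 'I_(k.*2)] && [forall B in p, ~~ odd #|B|].

Definition source_partition (k n : nat) (m : current n) : set_system_S k :=
  equivalence_partition (fun i j : 'I_(k.*2) => connected_in m i j)
    [set: 'I_(k.*2)].

Definition cluster_vector (R : realType) (k n : nat) (m : current n) :
    'rV[R]_(k.*2) :=
  \row_i (#|ccluster m i|%:R / Num.sqrt n%:R).

Definition cluster_data (R : realType) (k n : nat) (m : current n) : ambient R k :=
  (cluster_vector R k m, source_partition k m).

(* (R_{>=0})^{2k} x P_even(S), as a closed subset of the ambient space. *)
Definition state_space (R : realType) (k : nat) :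
    set (ambient R k) :=
  fun x => (forall i, 0 <= x.1 0 i) /\
           even_partition (x.2 : {set {set 'I_(k.*2)}}).

Definition borel (E : ptopologicalType) := g_sigma_algebraType (@open E).

Definition independent_RV d d1 d2 (T : measurableType d)
    (T1 : measurableType d1) (T2 : measurableType d2) (R : realType)
    (P : probability T R) (X : T -> T1) (Y : T -> T2) : Prop :=
  forall (A : set T1) (B : set T2), measurable A -> measurable B ->
    P (X @^-1` A `&` Y @^-1` B) = (P (X @^-1` A) * P (Y @^-1` B))%E.

(* Xn n is defined on T n and X on T'; only the laws of these variables
   matter. *)
Definition cvg_in_distribution (R : realType) (E : topologicalType)
    (d : nat -> measure_display) (T : forall n, measurableType (d n))
    (P : forall n, probability (T n) R) (Xn : forall n, T n -> E)
    (d' : measure_display) (T' : measurableType d')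
    (P' : probability T' R) (X : T' -> E) : Prop :=
  forall f : E -> R, continuous f -> (exists M : R, forall x, `|f x| <= M) ->
    (fun n => 'E_(P n)[f \o Xn n])%E @ \oo --> ('E_P'[f \o X])%E.

Definition euclidean_norm (R : realType) (N : nat) (x : 'rV[R]_N) : R :=
  Num.sqrt (\sum_i x 0 i ^+ 2).

Definition gaussian_tails (R : realType) (N : nat) (d : measure_display)
    (T : measurableType d) (P : probability T R) (Y : T -> 'rV[R]_N) : Prop :=
  exists2 c : R, 0 < c & forall t : R, 1 <= t ->
    (P [set w | (t <= euclidean_norm (Y w))%R]
       <= (c^-1 * expR (- c * t ^+ 2))%:E)%E.

(* Main.v *)
(* Since n_1 <= n_1 + n_2, it suffices to control the clusters of the double
   current N = n_1 + n_2.  Write e = {x, y}, sigma_e = sigma_x sigma_y, and let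
   sigma, tau be two spin configurations, eta = sigma tau.  From
   sigma_e + tau_e = sigma_e (1 + eta_e) and the expansion of
   exp (d sum_e (sigma_e + tau_e)), the law of N can be coupled with signs eta that
   are constant on the clusters of N and uniform given N.  Averaging
   exp (s sum_x eta_x) over these signs gives at least cosh (s |C_x(N)|), so that
     E cosh (s |C_x(N)|) <= <sigma_S exp (s sum_x sigma_x tau_x)> / <sigma_S>
   for two independent Curie-Weiss models.  A Gaussian linearization of both
   quadratic Hamiltonians factorizes the spin sums, and at s = h / sqrt n, in the
   variables u = phi / n^(1/4), v = psi / n^(1/4), the quartic bound on log cosh
   shows that the right-hand side is at most K exp (C h^2) for n large.  Chernoff's
   bound with h proportional to rho gives P(|C_x(N)| >= rho sqrt n) <=
   K exp (- a rho^2), which passes to the limit in distribution. *)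

Require Import Defs.
From HB Require Import structures.
From mathcomp Require Import all_boot all_order all_algebra.
From mathcomp Require Import all_classical all_reals all_analysis.
From mathcomp Require Import measurable_realfun.
From mathcomp Require Import ring lra.

Set Implicit Arguments.
Unset Strict Implicit.
Unset Printing Implicit Defensive.

Import Order.TTheory GRing.Theory Num.Theory.
Import numFieldNormedType.Exports.

Local Open Scope classical_set_scope.
Local Open Scope ring_scope.

(** * Gaussian transforms of exponential sums *)

Section Gaussian.
Variable R : realType.
Implicit Types (q b x : R).
Local Notation mu := (@lebesgue_measure R).

(** The unnormalized centred Gaussian density of variance [q]; [gauss_mass q] is its total mass. *)
Definition gauss_weight q x : R := expR (- x ^+ 2 / (q *+ 2)).
Definition gauss_mass q : R := Num.sqrt (q * pi *+ 2).

Lemma gauss_mass_gt0 q : 0 < q -> 0 < gauss_mass q.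
Proof. by move=> q0; rewrite sqrtr_gt0 pmulrn_rgt0// mulr_gt0// pi_gt0. Qed.

(** Completing the square: the exponential tilt moves the mean to [q * b]. *)
Lemma exp_gauss_weightE q b x : 0 < q ->
  expR (b * x) * gauss_weight q x =
  (gauss_mass q * expR (q * b ^+ 2 / 2)) * normal_pdf (q * b) (Num.sqrt q) x.
Proof.
move=> q0; have s0 : Num.sqrt q != 0 by rewrite gt_eqF// sqrtr_gt0.
rewrite normal_pdfE// /normal_peak /normal_fun sqr_sqrtr ?ltW//.
rewrite /gauss_weight -/(gauss_mass q) mulrAC mulrA mulfV ?mul1r; last first.
  by rewrite gt_eqF ?gauss_mass_gt0.
rewrite -!expRD; congr expR; field; lra.
Qed.

Lemma integrable_exp_gauss_weight q b : 0 < q ->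
  mu.-integrable setT (fun x => (expR (b * x) * gauss_weight q x)%:E).
Proof.
move=> q0; under eq_fun do rewrite exp_gauss_weightE// EFinM.
apply: integrableZl => //.
by apply: integrable_normal_pdf; rewrite gt_eqF// sqrtr_gt0.
Qed.

(** Hubbard-Stratonovich identity: read from right to left, it replaces a quadratic exponent in [b]
    by a Gaussian mixture of linear ones. *)
Lemma Rintegral_exp_gauss_weight q b : 0 < q ->
  (\int[mu]_x (expR (b * x) * gauss_weight q x))%R =
  gauss_mass q * expR (q * b ^+ 2 / 2).
Proof.
move=> q0; under eq_Rintegral do rewrite exp_gauss_weightE//.
have s0 : Num.sqrt q != 0 by rewrite gt_eqF// sqrtr_gt0.
rewrite RintegralZl//; last exact: integrable_normal_pdf.
by rewrite /Rintegral integral_normal_pdf//= mulr1.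
Qed.

Variables (I : finType) (c a : I -> R) (q : R).
Hypothesis q_gt0 : 0 < q.
Let f x := gauss_weight q x * \sum_i c i * expR (a i * x).

Let fE x : f x = \sum_i c i * (expR (a i * x) * gauss_weight q x).
Proof. by rewrite /f mulr_sumr; apply: eq_bigr => i _; ring. Qed.

Let integrable_term i :
  mu.-integrable setT (fun x => (c i * (expR (a i * x) * gauss_weight q x))%:E).
Proof.
under eq_fun do rewrite EFinM.
by apply: integrableZl => //; exact: integrable_exp_gauss_weight.
Qed.

Let integrable_f : mu.-integrable setT (EFin \o f).
Proof.
rewrite (_ : _ \o _ = fun x =>
    (\sum_(i in I) (c i * (expR (a i * x) * gauss_weight q x))%:E)%E); last first.
  by apply/funext => x /=; rewrite fE sumEFin.
by apply: integrable_sum => // i _; exact: integrable_term.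
Qed.

Let Rintegral_f :
  (\int[mu]_x f x)%R = gauss_mass q * \sum_i c i * expR (q * a i ^+ 2 / 2).
Proof.
rewrite /Rintegral; under eq_integral do rewrite fE -sumEFin.
rewrite integral_sum// -sum_fine.
  rewrite mulr_sumr; apply: eq_bigr => i _; rewrite mulrCA.
  rewrite -Rintegral_exp_gauss_weight// -RintegralZl//.
  exact: integrable_exp_gauss_weight.
by move=> i _; apply: integrable_fin_num.
Qed.

(** The left-hand side is the integral of [f], so a bound is required only after the cancellations
    between terms of different signs. *)
Lemma gauss_transform_le (K : R) :
  (forall x, f x <= K * expR (- x ^+ 2)) ->
  gauss_mass q * \sum_i c i * expR (q * a i ^+ 2 / 2) <= K * Num.sqrt pi.
Proof.
move=> fK; rewrite -Rintegral_f.
have -> : K * Num.sqrt pi = (\int[mu]_x (K * gauss_fun x))%R.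
  rewrite RintegralZl//; last exact: integrableT_gauss.
  by rewrite /Rintegral integralT_gauss.
apply: le_Rintegral => //.
rewrite (_ : _ \o _ = fun x => (K%:E * (gauss_fun x)%:E)%E)//.
by apply: integrableZl => //; exact: integrableT_gauss.
Qed.

(** The integral of the nonnegative [f] is at least its part over [[1, 2]], an interval of length
    one. *)
Lemma gauss_transform_ge (K : R) : (forall x, 0 <= f x) ->
  (forall x, 1 <= x <= 2 -> K <= f x) ->
  K <= gauss_mass q * \sum_i c i * expR (q * a i ^+ 2 / 2).
Proof.
move=> f0 fK; rewrite -Rintegral_f.
have mI : measurable (`[1, 2]%classic : set R) by [].
have muI : mu `[1%R, 2%R]%classic = 1%E.
  by rewrite lebesgue_measure_itv/= lte_fin ltr1n -EFinD; congr EFin; lra.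
have -> : K = (\int[mu]_(x in `[1, 2]) K)%R.
  by rewrite Rintegral_cst// [X in fine X](_ : _ = 1%E)//= mulr1.
have intI : mu.-integrable `[1, 2]%classic (EFin \o f).
  exact: integrableS integrable_f.
apply: (@le_trans _ _ (\int[mu]_(x in `[1, 2]) f x)%R).
  apply: le_Rintegral => //.
  apply/integrableP; split => //. by exact: measurable_cst.
  by rewrite integral_cst//= [X in (_ * X)%E](_ : _ = 1%E)// mule1 ltry.
rewrite -lee_fin /Rintegral !fineK; [|exact: integrable_fin_num..].
apply: ge0_subset_integral => //.
- by have /integrableP[] := integrable_f.
- by move=> x _; rewrite lee_fin.
Qed.

End Gaussian.

(** * Hyperbolic functions *)

Section Hyperbolic.
Variable R : realType.
Implicit Types x u : R.

Definition ch x : R := (expR x + expR (- x)) / 2.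
Definition sh x : R := (expR x - expR (- x)) / 2.

Lemma ch_ge1 x : 1 <= ch x.
Proof. have := expR_ge1Dx x; have := expR_ge1Dx (- x); rewrite /ch; lra. Qed.

Lemma ch_ge0 x : 0 <= ch x.
Proof. by rewrite (le_trans ler01)// ch_ge1. Qed.

Lemma ch0 : ch 0 = 1.
Proof. by rewrite /ch oppr0 expR0; field. Qed.

Lemma sh0 : sh 0 = 0.
Proof. by rewrite /sh oppr0 subrr mul0r. Qed.

Lemma chN x : ch (- x) = ch x. Proof. by rewrite /ch opprK addrC. Qed.

Lemma shN x : sh (- x) = - sh x.
Proof. by rewrite /sh opprK; field. Qed.

Lemma ch_double x : ch (2 * x) = 2 * ch x ^+ 2 - 1.
Proof.
rewrite /ch (_ : 2 * x = x + x); last by ring.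
rewrite opprD !expRD; have := expRxMexpNx_1 x.
set a := expR x; set b := expR (- x) => ab.
by transitivity (2 * ((a + b) / 2) ^+ 2 - a * b); [field|rewrite ab].
Qed.

Lemma is_derive_ch x : is_derive x 1 ch (sh x).
Proof.
rewrite /ch /sh; apply: is_derive_eq.
by rewrite !scaler0 add0r -[_ *: _]/(_ * _); field.
Qed.

Lemma is_derive_sh x : is_derive x 1 sh (ch x).
Proof.
rewrite /ch /sh; apply: is_derive_eq.
by rewrite !scaler0 add0r -[_ *: _]/(_ * _); field.
Qed.

Lemma le_of_derive_ge0 (f df : R -> R) :
  (forall x, is_derive x 1 f (df x)) -> (forall x, 0 <= x -> 0 <= df x) ->
  forall x, 0 <= x -> f 0 <= f x.
Proof.
move=> fdf df0 x x0.
have [] // := @MVT_segment R f df 0 x x0.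
  apply: derivable_within_continuous => y _; by have := fdf y; case.
move=> c; rewrite in_itv/= subr0 => /andP[c0 _] /eqP; rewrite subr_eq => /eqP ->.
by rewrite lerDr mulr_ge0// df0.
Qed.

Lemma sh_ge x : 0 <= x -> x <= sh x.
Proof.
move=> x0; rewrite -subr_ge0.
have := @le_of_derive_ge0 (fun x => sh x - x) (fun x => ch x - 1) _ _ x x0.
rewrite sh0 subrr; apply.
  by move=> y; have ? := is_derive_sh y; apply: is_derive_eq.
by move=> y _; rewrite subr_ge0 ch_ge1.
Qed.

Lemma sh_le x : 0 <= x -> sh x <= x * ch x.
Proof.
move=> x0; rewrite -subr_ge0.
have := @le_of_derive_ge0 (fun x => x * ch x - sh x) (fun x => x * sh x) _ _ x x0.
rewrite sh0 mul0r subrr; apply.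
  move=> y; have := is_derive_sh y; have := is_derive_ch y => ? ?.
  by apply: is_derive_eq; rewrite -![_ *: _]/(_ * _); ring.
by move=> y y0; rewrite mulr_ge0// (le_trans y0)// sh_ge.
Qed.

Lemma normr_sh_le x : `|sh x| <= `|x| * ch x.
Proof.
have [x0|x0] := leP 0 x.
  by rewrite !ger0_norm ?sh_le// (le_trans x0)// sh_ge.
have x1 : 0 <= - x by lra.
rewrite -[sh x]opprK -shN normrN -(normrN x) -(chN x).
by rewrite !ger0_norm ?sh_le// (le_trans x1)// sh_ge.
Qed.

(** On the positive half-line [ch x * expR (- (x ^+ 2 / 2))] decreases from 1, its derivative having
    the sign of [sh x - x * ch x]. *)
Lemma ch_le_expR_sqr x : ch x <= expR (x ^+ 2 / 2).
Proof.
wlog x0 : x / 0 <= x => [H|].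
  have [|x0] := leP 0 x; first exact: H.
  by rewrite -chN -sqrrN H//; lra.
rewrite -subr_ge0.
suff: 0 <= 1 - ch x * expR (- (x ^+ 2 / 2)).
  by rewrite expRN !subr_ge0 ler_pdivrMr ?expR_gt0// mul1r.
have := @le_of_derive_ge0 (fun x => 1 - ch x * expR (- (x ^+ 2 / 2)))
  (fun x => (x * ch x - sh x) * expR (- (x ^+ 2 / 2))) _ _ x x0.
rewrite ch0 expr0n/= mul0r oppr0 expR0 mulr1 subrr; apply.
  move=> y; have ? := is_derive_ch y.
  by apply: is_derive_eq; rewrite /GRing.scale/=; field.
by move=> y y0; rewrite mulr_ge0 ?expR_ge0// subr_ge0 sh_le.
Qed.

Lemma ch_le_expR_norm x : ch x <= expR `|x|.
Proof.
have h (y : R) : 0 <= y -> expR (- y) <= expR y by move=> y0; rewrite ler_expR; lra.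
rewrite /ch; have [x0|x0] := leP 0 x.
  by rewrite ger0_norm//; have := h x x0; lra.
have x1 : 0 <= - x by lra.
by rewrite ltr0_norm//; have := h (- x) x1; rewrite opprK; lra.
Qed.

(* With [q := expR (- u ^+ 2)], [ch (2 * u) <= 2 / q - 1], and
   [q ^+ 2 * (2 / q - 1) = 1 - (1 - q) ^+ 2]. *)
Lemma ch_le_quartic x : `|x| <= 4 -> ch x <= expR (x ^+ 2 / 2 - x ^+ 4 / 400).
Proof.
move=> x4; pose u := x / 2; pose q := expR (- u ^+ 2).
have q0 : 0 < q by exact: expR_gt0.
have xE : x = 2 * u by rewrite /u; field.
have u4 : u ^+ 2 <= 4.
  by move: x4; rewrite ler_norml => /andP[? ?]; rewrite /u; nra.
have chq : ch u ^+ 2 * q <= 1.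
  rewrite /q expRN ler_pdivrMr ?expR_gt0// mul1r.
  have := ch_le_expR_sqr u; rewrite -(ler_pXn2r (_ : 0 < 2)%N)// ?nnegrE; last 2 first.
    by rewrite (le_trans ler01)// ch_ge1.
    by rewrite expR_ge0.
  by rewrite -expRM_natl (_ : 2%:R * (u ^+ 2 / 2) = u ^+ 2)//; field.
have qle : q * (1 + u ^+ 2) <= 1.
  by rewrite /q expRN mulrC ler_pdivrMr ?expR_gt0// mul1r expR_ge1Dx.
(* Here [u ^+ 2 <= 4] enters: it gives [1 / (1 + u ^+ 2) <= 1 - u ^+ 2 / 5]. Thus [1 - q] is at
   least [u ^+ 2 / 5], whose square is [x ^+ 4 / 400]. *)
have q1 : q * 5 <= 5 - u ^+ 2 by nra.
have main : ch x * q ^+ 2 <= 1 - (u ^+ 2 / 5) ^+ 2.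
  rewrite xE ch_double.
  have -> : (2 * ch u ^+ 2 - 1) * q ^+ 2 = 2 * q * (ch u ^+ 2 * q) - q ^+ 2 by ring.
  have : 2 * q * (ch u ^+ 2 * q) <= 2 * q * 1 by rewrite ler_pM2l//; lra.
  by nra.
have -> : x ^+ 2 / 2 - x ^+ 4 / 400 = 2%:R * (u ^+ 2) - (u ^+ 2 / 5) ^+ 2.
  by rewrite xE; field.
rewrite expRD expRM_natl.
have -> : expR (u ^+ 2) = q^-1 by rewrite /q expRN invrK.
rewrite exprVn mulrC ler_pdivlMr ?exprn_gt0// (le_trans main)//.
by rewrite (le_trans _ (expR_ge1Dx _)).
Qed.

Lemma expR_poly_bound (j : nat) (y : R) : 0 <= y -> y ^+ j <= j`!%:R * expR y.
Proof.
move=> y0; case: j => [|j].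
  by rewrite expr0 fact0 mul1r (le_trans _ (expR_ge1Dx _))//; lra.
have := expR_ge1Dxn j y0.
rewrite -[_ <= j.+1`!%:R * _]ler_pdivrMl ?ltr0n ?fact_gt0// mulrC.
lra.
Qed.

End Hyperbolic.

Lemma ler_ch (R : realType) (y z : R) : 0 <= y -> y <= z -> ch y <= ch z.
Proof.
move=> y0 yz; rewrite -subr_ge0.
have -> : ch z - ch y = (expR z - expR y) * (1 - expR (- z) * expR (- y)) / 2.
  rewrite /ch.
  have := expRxMexpNx_1 y; have := expRxMexpNx_1 z.
  set a := expR z; set b := expR (- z); set a' := expR y; set b' := expR (- y).
  move=> ab ab'.
  have -> : (a - a') * (1 - b * b') = a - a' - (a * b) * b' + (a' * b') * b by ring.
  by rewrite ab ab'; field.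
rewrite divr_ge0// mulr_ge0 ?subr_ge0 ?ler_expR// -expRD -expR0 ler_expR.
by lra.
Qed.

(** * The field density in the critical window *)

Section FieldWeight.
Variables (R : realType) (lambda r w : R) (n : nat).
Hypotheses (w_gt0 : 0 < w) (rE : w ^+ 2 = r) (nE : n%:R = r ^+ 2).
Hypothesis lambda_lt : `|lambda| * 2 <= r.
Implicit Types x h : R.

Let r_gt0 : 0 < r. Proof. by rewrite -rE exprn_gt0. Qed.
Let r_neq0 : r != 0. Proof. by rewrite gt_eqF. Qed.
Let w_neq0 : w != 0. Proof. by rewrite gt_eqF. Qed.

(* The variance making [expR (q * (m / w) ^+ 2 / 2)] the Curie-Weiss weight of
   the magnetization [m]. *)
Definition field_var : R := (1 - lambda / r) / r.

Let z := lambda / r.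
Let z_bound : - (1 / 2) <= z <= 1 / 2.
Proof.
rewrite -ler_norml /z normf_div (gtr0_norm r_gt0) ler_pdivrMr//.
by move: lambda_lt; lra.
Qed.

Lemma field_var_gt0 : 0 < field_var.
Proof. by rewrite /field_var divr_gt0// -/z; have := z_bound; lra. Qed.

(** In use, [r] is the square root and [w] the fourth root of [n]; the coupling on the right is then
    [dn n lambda]. *)
Lemma field_var_coupling x :
  field_var * (x / w) ^+ 2 / 2 = (1 - lambda / r) / n%:R * x ^+ 2 / 2.
Proof. by rewrite /field_var nE -rE; field. Qed.

Let gauss_weightE x :
  gauss_weight field_var x = expR (- (r * x ^+ 2 / 2) * (1 - z)^-1).
Proof.
rewrite /gauss_weight /field_var -/z; congr expR; field.
by rewrite r_neq0 /= gt_eqF//; have := z_bound; lra.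
Qed.

Let rzE : r * z = lambda. Proof. by rewrite /z; field. Qed.

(** Uses [1 + z <= (1 - z)^-1] for [z = lambda / r]. Since [r * z = lambda], the critical window
    changes the exponent by a quadratic term that does not grow with [r]. *)
Lemma gauss_weight_le x :
  gauss_weight field_var x <= expR (- (r * x ^+ 2 / 2) - lambda * x ^+ 2 / 2).
Proof.
rewrite gauss_weightE ler_expR.
have -> : - (r * x ^+ 2 / 2) - lambda * x ^+ 2 / 2 = - (r * x ^+ 2 / 2) * (1 + z).
  by rewrite -rzE; field.
rewrite !mulNr lerN2 ler_wpM2l//.
  by rewrite divr_ge0// mulr_ge0 ?sqr_ge0// ltW.
have z1 : 0 < 1 - z by have := z_bound; lra.
rewrite -[leRHS]mul1r ler_pdivlMr//; have := sqr_ge0 z; nra.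
Qed.

(** Uses [(1 - z)^-1 <= 1 + z + 2 * z ^+ 2] for [z = lambda / r] at most 1/2, together with
    [x ^+ 2 <= 4]. *)
Lemma gauss_weight_ge x : 1 <= x <= 2 ->
  expR (- (r * x ^+ 2 / 2) - 2 * `|lambda| - 4 * lambda ^+ 2 / r)
    <= gauss_weight field_var x.
Proof.
move=> /andP[x1 x2]; rewrite gauss_weightE ler_expR.
have z1 : 0 < 1 - z by have := z_bound; lra.
have zi : (1 - z)^-1 <= 1 + z + 2 * z ^+ 2.
  rewrite -[leLHS]mul1r ler_pdivrMr//; have := z_bound => /andP[? ?].
  have -> : (1 + z + 2 * z ^+ 2) * (1 - z) = 1 + z ^+ 2 * (1 - 2 * z) by ring.
  by rewrite lerDl mulr_ge0 ?sqr_ge0//; lra.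
have x4 : x ^+ 2 <= 4 by nra.
apply: (@le_trans _ _ (- (r * x ^+ 2 / 2) * (1 + z + 2 * z ^+ 2))); last first.
  by rewrite !mulNr lerN2 ler_wpM2l// divr_ge0// mulr_ge0 ?sqr_ge0// ltW.
have -> : - (r * x ^+ 2 / 2) * (1 + z + 2 * z ^+ 2) =
    - (r * x ^+ 2 / 2) - lambda * x ^+ 2 / 2 - lambda ^+ 2 / r * x ^+ 2.
  by rewrite /z; field.
have l1 : lambda * x ^+ 2 / 2 <= 2 * `|lambda|.
  have := ler_norm lambda; have := normr_ge0 lambda; have := sqr_ge0 x; nra.
have l2 : lambda ^+ 2 / r * x ^+ 2 <= 4 * lambda ^+ 2 / r.
  rewrite -[4 * _ / r]mulrA [leLHS]mulrC ler_wpM2r//.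
  by rewrite divr_ge0 ?sqr_ge0// ltW.
lra.
Qed.

(** Put [u = x / w]. For |u| <= 4 the quartic bound on [ch] cancels the term [r * x ^+ 2 / 2] of the
    Gaussian weight and leaves [- x ^+ 4 / 400], which absorbs every quadratic term. For |u| > 4,
    log ch u <= |u| <= u^2 / 4 leaves half of the Gaussian exponent, which is enough because
    [r >= 4 * B]. *)
Lemma weight_ch_le h x : 0 <= h -> 4 * (`|lambda| / 2 + h / 2 + 2) <= r ->
  gauss_weight field_var x * ch (x / w) ^+ n * expR ((h / 2 + 1) * x ^+ 2)
    <= expR (100 * (`|lambda| / 2 + h / 2 + 2) ^+ 2) * expR (- x ^+ 2).
Proof.
move=> h0; set B := `|lambda| / 2 + h / 2 + 2 => Br.
have B0 : 0 <= B by rewrite /B; have := normr_ge0 lambda; lra.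
(* [B] exceeds the coefficient |lambda| / 2 + h / 2 + 1 by one, which makes room for
   [expR (- x ^+ 2)]. *)
have lB : - lambda * x ^+ 2 / 2 + (h / 2 + 1) * x ^+ 2 <= (B - 1) * x ^+ 2.
  have := ler_norm (- lambda); rewrite normrN /B; have := sqr_ge0 x; nra.
have x2w : (x / w) ^+ 2 * r = x ^+ 2 by rewrite -rE; field.
set u := x / w in x2w *.
have [u4|u4] := leP `|u| 4.
  have chn : ch u ^+ n <= expR (n%:R * (u ^+ 2 / 2 - u ^+ 4 / 400)).
    rewrite expRM_natl lerXn2r ?nnegrE ?expR_ge0 ?ch_le_quartic//.
    by rewrite (le_trans ler01)// ch_ge1.
  apply: (@le_trans _ _ (expR (- (r * x ^+ 2 / 2) - lambda * x ^+ 2 / 2) *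
     expR (n%:R * (u ^+ 2 / 2 - u ^+ 4 / 400)) * expR ((h / 2 + 1) * x ^+ 2))).
    rewrite ler_wpM2r ?expR_ge0// ler_pM ?expR_ge0 ?gauss_weight_le//.
    by rewrite exprn_ge0// (le_trans ler01)// ch_ge1.
  rewrite -!expRD ler_expR nE.
  have -> : r ^+ 2 * (u ^+ 2 / 2 - u ^+ 4 / 400) = r * x ^+ 2 / 2 - x ^+ 4 / 400.
    by rewrite (exprM x 2 2) -x2w; field.
  (* This square balances the quartic gain against [B * x ^+ 2]; its constant term is the exponent
     [100 * B ^+ 2]. *)
  have : 0 <= (x ^+ 2 / 20 - 10 * B) ^+ 2 by exact: sqr_ge0.
  have -> : (x ^+ 2 / 20 - 10 * B) ^+ 2 = x ^+ 4 / 400 - B * x ^+ 2 + 100 * B ^+ 2.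
    by field.
  by lra.
have chn : ch u ^+ n <= expR (n%:R * (u ^+ 2 / 4)).
  rewrite expRM_natl lerXn2r ?nnegrE ?expR_ge0 ?(le_trans ler01) ?ch_ge1//.
  rewrite (le_trans (ch_le_expR_norm u))// ler_expR.
  by rewrite -(real_normK (num_real u)); nra.
apply: (@le_trans _ _ (expR (- (r * x ^+ 2 / 2) - lambda * x ^+ 2 / 2) *
     expR (n%:R * (u ^+ 2 / 4)) * expR ((h / 2 + 1) * x ^+ 2))).
  rewrite ler_wpM2r ?expR_ge0// ler_pM ?expR_ge0 ?gauss_weight_le//.
  by rewrite exprn_ge0// (le_trans ler01)// ch_ge1.
rewrite -!expRD ler_expR nE.
have -> : r ^+ 2 * (u ^+ 2 / 4) = r * x ^+ 2 / 4 by rewrite -x2w; field.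
have : 0 <= 100 * B ^+ 2 by rewrite mulr_ge0 ?sqr_ge0.
have : 4 * B * x ^+ 2 <= r * x ^+ 2 by rewrite ler_wpM2r ?sqr_ge0.
by lra.
Qed.

(** With [y = (x / w) ^+ 2 / 2] one has [expR (y - y ^+ 2) <= 1 + y <= ch (x / w)]. Here
    [n * y = r * x ^+ 2 / 2] cancels the leading Gaussian term and [n * y ^+ 2 = (x ^+ 2 / 2) ^+ 2]
    is at most 4, so the bound is free of [n]. *)
Lemma weight_ch_ge x : 1 <= r -> 1 <= x <= 2 ->
  expR (- (4 + 2 * `|lambda| + 4 * lambda ^+ 2))
    <= gauss_weight field_var x * ch (x / w) ^+ n.
Proof.
move=> r1 x12; have := gauss_weight_ge x12 => gw.
have /andP[x1 x2] := x12.
pose y := (x / w) ^+ 2 / 2.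
have y0 : 0 <= y by rewrite divr_ge0 ?sqr_ge0.
have yr : y * r = x ^+ 2 / 2 by rewrite /y -rE; field.
have chy : 1 + y <= ch (x / w).
  have := @le_of_derive_ge0 R (fun t => ch t - t ^+ 2 / 2) (fun t => sh t - t) _ _ (x / w).
  rewrite ch0 expr0n/= mul0r subr0 /y => H.
  suff : 1 <= ch (x / w) - (x / w) ^+ 2 / 2 by lra.
  apply: H => [t|t t0|]; last by rewrite divr_ge0 ?ltW//; lra.
    by have ? := is_derive_ch t; apply: is_derive_eq; rewrite /GRing.scale/=; field.
  by rewrite subr_ge0 sh_ge.
have ey : expR (y - y ^+ 2) <= 1 + y.
  rewrite -[y - _]opprK expRN -[leLHS]mul1r ler_pdivrMr ?expR_gt0//.
  apply: (@le_trans _ _ ((1 + y) * (1 - (y - y ^+ 2)))); last first.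
    by rewrite ler_wpM2l ?expR_ge1Dx//; lra.
  have -> : (1 + y) * (1 - (y - y ^+ 2)) = 1 + y ^+ 3 by ring.
  by rewrite lerDl exprn_ge0.
apply: (@le_trans _ _ (expR (- (r * x ^+ 2 / 2) - 2 * `|lambda| - 4 * lambda ^+ 2 / r) *
    expR (n%:R * (y - y ^+ 2)))); last first.
  rewrite ler_pM ?expR_ge0// expRM_natl lerXn2r ?nnegrE ?expR_ge0 ?(le_trans ey)//.
  by rewrite (le_trans ler01)// ch_ge1.
rewrite -expRD ler_expR nE.
have -> : r ^+ 2 * (y - y ^+ 2) = r * (x ^+ 2 / 2) - (x ^+ 2 / 2) ^+ 2.
  by rewrite -yr; ring.
have : 4 * lambda ^+ 2 / r <= 4 * lambda ^+ 2.
  by rewrite ler_pdivrMr// ler_peMr// mulr_ge0 ?sqr_ge0.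
have : (x ^+ 2 / 2) ^+ 2 <= 4.
  have : x ^+ 2 <= 4 by nra.
  have := sqr_ge0 x; nra.
lra.
Qed.

End FieldWeight.

(** * Spin sums *)

Section SpinSums.
Variables (R : realType) (n : nat).
Implicit Types (sigma tau : {ffun 'I_n -> bool}) (S : {set 'I_n}) (s u v : R).

Definition spin sigma i : R := (-1) ^+ sigma i.
Definition spin_prod S sigma : R := \prod_(i in S) spin sigma i.
Definition mag sigma : R := \sum_i spin sigma i.
Definition overlap sigma tau : R := \sum_i spin sigma i * spin tau i.

Lemma sum_prod_spins (F : 'I_n -> bool -> R) :
  \sum_(sigma : {ffun 'I_n -> bool}) \prod_i F i (sigma i) =
  \prod_i (F i true + F i false).
Proof. by rewrite -bigA_distr_bigA/=; apply: eq_bigr => i _; rewrite big_bool. Qed.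

Lemma spin_prod_mkcond S sigma :
  spin_prod S sigma = \prod_i (if i \in S then spin sigma i else 1).
Proof. by rewrite /spin_prod big_mkcond. Qed.

Lemma sum_spin_prod_exp S u :
  \sum_sigma spin_prod S sigma * expR (u * mag sigma) =
  \prod_i (if i \in S then 2 * sh u else 2 * ch u).
Proof.
pose F i (b : bool) := (if i \in S then (-1) ^+ b else 1) * expR (u * (-1) ^+ b).
transitivity (\sum_(sigma : {ffun 'I_n -> bool}) \prod_i F i (sigma i)).
  apply: eq_bigr => sigma _; rewrite /F big_split/= spin_prod_mkcond.
  by rewrite /mag mulr_sumr expR_sum.
rewrite sum_prod_spins; apply: eq_bigr => i _.
by rewrite /F /= expr0 expr1 mulr1 mulrN1 /sh /ch; case: ifP => _; field.
Qed.

(** With linear fields the only coupling left is between [sigma i] and [tau i], so the double sum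
    factorizes over sites into sums over four sign pairs. *)
Lemma sum_spin_prod_exp2 S s u v :
  \sum_sigma \sum_tau spin_prod S sigma *
    expR (s * overlap sigma tau + u * mag sigma + v * mag tau) =
  \prod_i (if i \in S then 4 * (sh u * ch v * ch s + ch u * sh v * sh s)
           else 4 * (ch u * ch v * ch s + sh u * sh v * sh s)).
Proof.
(* [F i] is the weight of site [i] once [tau i] has been summed out. *)
pose F i (b : bool) := (if i \in S then (-1) ^+ b else 1) * expR (u * (-1) ^+ b) *
  (expR (- (s * (-1) ^+ b + v)) + expR (s * (-1) ^+ b + v)).
transitivity (\sum_(sigma : {ffun 'I_n -> bool}) \prod_i F i (sigma i)).
  apply: eq_bigr => sigma _.
  rewrite /F !big_split/= -spin_prod_mkcond -expR_sum -mulr_sumr -/(mag sigma).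
  rewrite -mulrA -mulr_sumr; congr (_ * _).
  pose G i (b : bool) := expR ((s * spin sigma i + v) * (-1) ^+ b).
  transitivity (\sum_(tau : {ffun 'I_n -> bool})
      expR (u * mag sigma) * \prod_i G i (tau i)).
    apply: eq_bigr => tau _; rewrite /G -expR_sum -expRD; congr expR.
    rewrite addrAC addrC; congr (_ + _).
    rewrite /overlap /mag !mulr_sumr -big_split/=; apply: eq_bigr => i _.
    by rewrite mulrDl mulrA.
  rewrite -mulr_sumr sum_prod_spins; congr (_ * _); apply: eq_bigr => i _.
  by rewrite /G /= expr0 expr1 mulr1 mulrN1.
rewrite sum_prod_spins; apply: eq_bigr => i _.
rewrite /F /= expr0 expr1 !mulr1 !mulrN1 /sh /ch !opprD !opprK !expRD.
by case: ifP => _; field.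
Qed.

(** A source site gains the small factor |u| + |v|: each of its two terms contains [sh u] or [sh v],
    and |sh x| <= |x| ch x. The factor [sh s] is bounded by [ch s] because [s <= 1]. *)
Lemma normr_source_factor_le s u v : 0 <= s <= 1 ->
  `|4 * (sh u * ch v * ch s + ch u * sh v * sh s)| <=
  4 * (ch u * ch v) * expR (s ^+ 2 / 2 + s * `|u| * `|v|) * (`|u| + `|v|).
Proof.
move=> /andP[s0 s1]; have c0 := @ch_ge0 R.
rewrite normrM (ger0_norm (ler0n _ _)) -!(mulrA 4) ler_wpM2l//.
apply: (@le_trans _ _ (ch u * ch v * ch s * (`|u| + `|v|))).
  have ss1 : `|sh s| <= ch s.
    by rewrite (le_trans (normr_sh_le _))// ger0_norm// ler_piMl.
  move: (normr_sh_le u) (normr_sh_le v) ss1 (c0 u) (c0 v) (c0 s).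
  move: (sh u) (ch u) (sh v) (ch v) (sh s) (ch s) => su cu sv cv ss cs su1 sv1 ss1 *.
  rewrite (le_trans (ler_normD _ _))// !normrM !(@ger0_norm _ cu)//.
  rewrite !(@ger0_norm _ cv)// !(@ger0_norm _ cs)//.
  have -> : cu * cv * cs * (`|u| + `|v|) =
    `|u| * cu * (cv * cs) + cu * (`|v| * cv * cs) by ring.
  rewrite -!mulrA (mulrA `|u|) lerD//; first by rewrite ler_wpM2r ?mulr_ge0.
  by rewrite ler_wpM2l// mulrA ler_pM.
rewrite ler_wpM2r ?addr_ge0// ler_wpM2l ?mulr_ge0// (le_trans (ch_le_expR_sqr _))//.
by rewrite ler_expR lerDl !mulr_ge0.
Qed.

Lemma normr_factor_le s u v : 0 <= s ->
  `|4 * (ch u * ch v * ch s + sh u * sh v * sh s)| <=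
  4 * (ch u * ch v) * expR (s ^+ 2 / 2 + s * `|u| * `|v|).
Proof.
move=> s0; have c0 := @ch_ge0 R.
rewrite normrM (ger0_norm (ler0n _ _)) -!(mulrA 4) ler_wpM2l//.
apply: (@le_trans _ _ (ch u * ch v * (ch s * (1 + s * `|u| * `|v|)))).
  have ss1 : `|sh s| <= s * ch s.
    by rewrite (le_trans (normr_sh_le _))// ger0_norm.
  move: (normr_sh_le u) (normr_sh_le v) ss1 (c0 u) (c0 v) (c0 s).
  move: (sh u) (ch u) (sh v) (ch v) (sh s) (ch s) => su cu sv cv ss cs su1 sv1 ss1 *.
  rewrite (le_trans (ler_normD _ _))// !normrM !(@ger0_norm _ cu)//.
  rewrite !(@ger0_norm _ cv)// !(@ger0_norm _ cs)//.
  have -> : cu * cv * (cs * (1 + s * `|u| * `|v|)) =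
    cu * cv * cs + `|u| * cu * (`|v| * cv) * (s * cs) by ring.
  by rewrite lerD2l !ler_pM ?mulr_ge0.
rewrite ler_wpM2l ?mulr_ge0// expRD ler_pM ?ch_le_expR_sqr ?expR_ge1Dx//.
by rewrite addr_ge0 ?mulr_ge0.
Qed.

Lemma prod_if_source (S : {set 'I_n}) (a b : R) :
  \prod_i (a * (if i \in S then b else 1)) = a ^+ n * b ^+ #|S|.
Proof.
rewrite big_split/= prodr_const card_ord; congr (_ * _).
by rewrite -big_mkcond prodr_const.
Qed.

Lemma sum_spin_prod_exp2_le S s u v : 0 <= s <= 1 ->
  \sum_sigma \sum_tau spin_prod S sigma *
    expR (s * overlap sigma tau + u * mag sigma + v * mag tau) <=
  (4 * (ch u * ch v) * expR (s ^+ 2 / 2 + s * `|u| * `|v|)) ^+ n *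
  (`|u| + `|v|) ^+ #|S|.
Proof.
move=> s01; rewrite sum_spin_prod_exp2 -prod_if_source.
rewrite (le_trans (ler_norm _))// normr_prod; apply: ler_prod => i _.
rewrite normr_ge0/=; case: ifP => _; first exact: normr_source_factor_le.
by rewrite mulr1 normr_factor_le//; case/andP: s01.
Qed.

(** The sign of [sh u] enters to the even power [#|S|]; this covers negative values of the auxiliary
    field. *)
Lemma sum_spin_prod_exp_ge0 S u : ~~ odd #|S| ->
  0 <= \sum_sigma spin_prod S sigma * expR (u * mag sigma).
Proof.
move=> eS; have c0 : 0 <= 2 * ch u by rewrite mulr_ge0 ?ch_ge0.
rewrite sum_spin_prod_exp (bigID (mem S))/= mulr_ge0//; last first.
  by rewrite prodr_ge0// => i /negPf ->.
rewrite (eq_bigr (fun=> 2 * sh u)); last by move=> i ->.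
by rewrite prodr_const -[#|_|]odd_double_half (negPf eS) add0n -mul2n exprM exprn_ge0 ?sqr_ge0.
Qed.

(** On the unit interval [ch u <= 2], hence [u / 2 * ch u <= u <= sh u]. *)
Lemma sum_spin_prod_exp_ge S u : 0 <= u <= 1 ->
  (2 * ch u) ^+ n * (u / 2) ^+ #|S| <=
  \sum_sigma spin_prod S sigma * expR (u * mag sigma).
Proof.
move=> /andP[u0 u1]; rewrite sum_spin_prod_exp -prod_if_source.
have c0 : 0 <= 2 * ch u by rewrite mulr_ge0 ?ch_ge0.
apply: ler_prod => i _; rewrite mulr_ge0//=; last by case: ifP; rewrite ?divr_ge0.
case: ifP => _; last by rewrite mulr1.
rewrite -mulrA ler_wpM2l// (le_trans _ (sh_ge u0))//.
rewrite mulrCA -[leRHS]mulr1 ler_wpM2l// ler_pdivrMr// mul1r.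
rewrite (le_trans (ch_le_expR_sqr u))//.
have -> : u ^+ 2 / 2 = - - (u ^+ 2 / 2) by rewrite opprK.
rewrite expRN -[leLHS]mul1r ler_pdivrMr ?expR_gt0//.
have := expR_ge1Dx (- (u ^+ 2 / 2)); nra.
Qed.

End SpinSums.

(** * Curie-Weiss partition functions *)

(** The one-field bound is applied in [y] for fixed [x], and then in [x]. *)
Lemma gauss_transform2_le (R : realType) (I J : finType) (c : I -> J -> R)
    (a : I -> R) (b : J -> R) (q K : R) : 0 < q ->
  (forall x y, gauss_weight q x * gauss_weight q y *
      (\sum_i \sum_j c i j * expR (a i * x + b j * y))
    <= K * (expR (- x ^+ 2) * expR (- y ^+ 2))) ->
  gauss_mass q ^+ 2 *
    (\sum_i \sum_j c i j * expR (q * a i ^+ 2 / 2 + q * b j ^+ 2 / 2)) <= K * pi.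
Proof.
move=> q0 cK.
have step x : gauss_mass q * \sum_j (gauss_weight q x *
    \sum_i c i j * expR (a i * x)) * expR (q * b j ^+ 2 / 2) <=
    K * expR (- x ^+ 2) * Num.sqrt pi.
  apply: gauss_transform_le => // y.
  have := cK x y; rewrite mulrA -[_ * gauss_weight q y * _]mulrA mulrCA.
  rewrite exchange_big/= => /(le_trans _); apply.
  rewrite le_eqVlt; apply/orP; left; apply/eqP; congr (_ * _).
  rewrite mulr_sumr; apply: eq_bigr => j _; rewrite -mulrA mulr_suml.
  by congr (_ * _); apply: eq_bigr => i _; rewrite expRD mulrA.
have -> : K * pi = K * Num.sqrt pi * Num.sqrt pi.
  by rewrite -mulrA -expr2 sqr_sqrtr ?pi_ge0.
rewrite expr2 -mulrA.
have <- : \sum_i (gauss_mass q * \sum_j c i j * expR (q * b j ^+ 2 / 2)) *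
      expR (q * a i ^+ 2 / 2) = gauss_mass q *
    \sum_i \sum_j c i j * expR (q * a i ^+ 2 / 2 + q * b j ^+ 2 / 2).
  rewrite mulr_sumr; apply: eq_bigr => i _; rewrite -mulrA; congr (_ * _).
  by rewrite mulr_suml; apply: eq_bigr => j _; rewrite expRD -mulrA [expR _ * _]mulrC.
apply: gauss_transform_le => // x; have := step x; rewrite [leRHS]mulrAC => /(le_trans _); apply.
rewrite le_eqVlt; apply/orP; left; apply/eqP.
rewrite !mulr_sumr (eq_bigr (fun i => \sum_j gauss_mass q * gauss_weight q x *
    (c i j * expR (a i * x) * expR (q * b j ^+ 2 / 2)))); last first.
  by move=> i _; rewrite !mulr_sumr mulr_suml mulr_sumr; apply: eq_bigr => j _; ring.
rewrite exchange_big/=; apply: eq_bigr => j _.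
rewrite mulr_sumr mulr_suml mulr_sumr; apply: eq_bigr => i _; ring.
Qed.

Section CurieWeiss.
Variables (R : realType) (n : nat).
Implicit Types (S : {set 'I_n}) (d s : R).

(** The unnormalized Curie-Weiss correlation of the spins in [S] at coupling [d]; the empty set
    gives the partition function. [cw_overlap] is its analogue for two replicas tilted by their
    overlap. *)
Definition cw_sum S d : R :=
  \sum_sigma spin_prod R S sigma * expR (d * mag R sigma ^+ 2 / 2).

Definition cw_overlap S d s : R :=
  \sum_sigma \sum_tau spin_prod R S sigma * expR (s * overlap R sigma tau) *
    expR (d * mag R sigma ^+ 2 / 2 + d * mag R tau ^+ 2 / 2).

End CurieWeiss.

Section CurieWeissBounds.
Variables (R : realType) (lambda : R) (n : nat).
Let r : R := Num.sqrt n%:R.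
Let w : R := Num.sqrt r.
Hypothesis lambda_lt : `|lambda| * 2 <= r.
Hypothesis r_ge1 : 1 <= r.
Implicit Types (S : {set 'I_n}) (h : R).

Let r_gt0 : 0 < r. Proof. exact: lt_le_trans ltr01 r_ge1. Qed.
Let w_gt0 : 0 < w. Proof. by rewrite sqrtr_gt0. Qed.
Let w2 : w ^+ 2 = r. Proof. by rewrite sqr_sqrtr// ltW. Qed.
Let nE : n%:R = r ^+ 2. Proof. by rewrite sqr_sqrtr. Qed.
Let q := field_var lambda r.
Let q_gt0 : 0 < q. Proof. exact: (field_var_gt0 w_gt0 w2). Qed.
Let qE x : q * (x / w) ^+ 2 / 2 = dn n lambda * x ^+ 2 / 2.
Proof. by rewrite (field_var_coupling _ w_gt0 w2 nE) /dn -/r; congr (_ * _ / _); rewrite mulrC. Qed.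

(** Two Gaussian fields linearize the Hamiltonians and the spin sums factorize; the remaining bound
    is a product of one-field bounds. *)
Lemma cw_overlap_le S k h : #|S| = k.*2 -> 0 <= h ->
  4 * (`|lambda| / 2 + h / 2 + 2) <= r ->
  gauss_mass q ^+ 2 * cw_overlap S (dn n lambda) (h / r) <=
  4 ^+ n * expR (h ^+ 2 / 2) * ((2 / r) ^+ k * k`!%:R) *
    expR (100 * (`|lambda| / 2 + h / 2 + 2) ^+ 2) ^+ 2 * pi.
Proof.
move=> cS h0; set B := `|lambda| / 2 + h / 2 + 2 => Br.
have hr : 0 <= h / r <= 1.
  rewrite divr_ge0 ?(ltW r_gt0)//= ler_pdivrMr// mul1r.
  by move: Br; rewrite /B; have := normr_ge0 lambda; lra.
have -> : cw_overlap S (dn n lambda) (h / r) =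
  \sum_sigma \sum_tau spin_prod R S sigma * expR (h / r * overlap R sigma tau) *
    expR (q * (mag R sigma / w) ^+ 2 / 2 + q * (mag R tau / w) ^+ 2 / 2).
  by apply: eq_bigr => sigma _; apply: eq_bigr => tau _; rewrite !qE.
apply: gauss_transform2_le => // x y.
pose u := x / w; pose v := y / w.
have -> : \sum_sigma \sum_tau spin_prod R S sigma *
     expR (h / r * overlap R sigma tau) *
     expR (mag R sigma / w * x + mag R tau / w * y) =
  \sum_sigma \sum_tau spin_prod R S sigma *
     expR (h / r * overlap R sigma tau + u * mag R sigma + v * mag R tau).
  apply: eq_bigr => sigma _; apply: eq_bigr => tau _.
  rewrite -mulrA -expRD; congr (_ * expR _); rewrite /u /v; ring.
have gw0 z : 0 <= gauss_weight q z by exact: expR_ge0.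
apply: (le_trans (ler_wpM2l (mulr_ge0 (gw0 x) (gw0 y))
   (sum_spin_prod_exp2_le S u v hr))).
have uv : `|u| * `|v| = `|x| * `|y| / r.
  by rewrite !normf_div (gtr0_norm w_gt0) mulf_div -expr2 w2.
(* At [s = h / r] the quantities n s^2 and n s |u| |v| become h^2 and h |x| |y|, both free of [n];
   the second is split by 2 |x| |y| <= x^2 + y^2. *)
have e1 : expR ((h / r) ^+ 2 / 2 + h / r * `|u| * `|v|) ^+ n <=
    expR (h ^+ 2 / 2) * (expR (h / 2 * x ^+ 2) * expR (h / 2 * y ^+ 2)).
  rewrite -expRM_natl -!expRD ler_expR nE -mulrA uv.
  have -> : r ^+ 2 * ((h / r) ^+ 2 / 2 + h / r * (`|x| * `|y| / r)) =
    h ^+ 2 / 2 + h * (`|x| * `|y|) by field; rewrite gt_eqF.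
  rewrite lerD2l -mulrDr -(real_normK (num_real x)) -(real_normK (num_real y)).
  have := sqr_ge0 (`|x| - `|y|); nra.
(* The sources contribute the power [r ^- k]; the remaining polynomial in the fields is absorbed by
   an exponential at the price of [k!]. *)
have e2 : (`|u| + `|v|) ^+ #|S| <=
    (2 / r) ^+ k * k`!%:R * (expR (x ^+ 2) * expR (y ^+ 2)).
  rewrite cS -mul2n exprM.
  apply: (@le_trans _ _ ((2 / r * (x ^+ 2 + y ^+ 2)) ^+ k)).
    rewrite lerXn2r ?nnegrE ?sqr_ge0//.
      by rewrite mulr_ge0 ?addr_ge0 ?sqr_ge0// divr_ge0 ?(ltW r_gt0).
    have -> : 2 / r * (x ^+ 2 + y ^+ 2) = 2 * (`|u| ^+ 2 + `|v| ^+ 2).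
      rewrite !real_normK ?num_real// -w2 /u /v; field; rewrite gt_eqF//.
    have := sqr_ge0 (`|u| - `|v|); nra.
  rewrite exprMn -mulrA ler_wpM2l ?exprn_ge0 ?divr_ge0 ?(ltW r_gt0)//.
  by rewrite -expRD expR_poly_bound// addr_ge0 ?sqr_ge0.
have f1 := weight_ch_le w_gt0 w2 nE lambda_lt x h0 Br.
have f2 := weight_ch_le w_gt0 w2 nE lambda_lt y h0 Br.
have c0 (z : R) : 0 <= ch z ^+ n by rewrite exprn_ge0 ?ch_ge0.
apply: (@le_trans _ _ (gauss_weight q x * gauss_weight q y *
   ((4 ^+ n * (ch u ^+ n * ch v ^+ n) *
     (expR (h ^+ 2 / 2) * (expR (h / 2 * x ^+ 2) * expR (h / 2 * y ^+ 2)))) *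
    ((2 / r) ^+ k * k`!%:R * (expR (x ^+ 2) * expR (y ^+ 2)))))).
  rewrite ler_wpM2l ?mulr_ge0// ler_pM ?exprn_ge0 ?addr_ge0//.
    by rewrite !mulr_ge0 ?ch_ge0 ?expR_ge0.
  rewrite exprMn [(4 * _) ^+ n]exprMn [(ch u * _) ^+ n]exprMn.
  by rewrite ler_wpM2l// !mulr_ge0 ?exprn_ge0 ?ch_ge0.
have split_exp z : expR ((h / 2 + 1) * z ^+ 2) = expR (h / 2 * z ^+ 2) * expR (z ^+ 2).
  by rewrite -expRD; congr expR; ring.
rewrite !split_exp -/q -/u -/v in f1 f2.
have A0 : 0 <= 4 ^+ n * expR (h ^+ 2 / 2) * ((2 / r) ^+ k * k`!%:R).
  by rewrite !mulr_ge0 ?exprn_ge0 ?expR_ge0 ?divr_ge0 ?(ltW r_gt0).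
have pos z : 0 <= gauss_weight q z * ch (z / w) ^+ n *
    (expR (h / 2 * z ^+ 2) * expR (z ^+ 2)) by rewrite !mulr_ge0 ?expR_ge0.
have := ler_wpM2l A0 (ler_pM (pos x) (pos y) f1 f2).
rewrite -/u -/v => H; apply: (le_trans (le_trans _ H)).
  by rewrite le_eqVlt; apply/orP; left; apply/eqP; ring.
by rewrite le_eqVlt; apply/orP; left; apply/eqP; ring.
Qed.

(** Field values in [[1, 2]] suffice. From [4 <= r] follows [2 <= w], so [x / w] lies in the unit
    interval, and each pair of sources yields [(x / w / 2) ^+ 2 >= (4 * r)^-1]. *)
Lemma cw_sum_ge S k : #|S| = k.*2 -> 4 <= r ->
  2 ^+ n * expR (- (4 + 2 * `|lambda| + 4 * lambda ^+ 2)) / (4 * r) ^+ k <=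
  gauss_mass q * cw_sum S (dn n lambda).
Proof.
move=> cS r4.
have w2' : 2 <= w.
  rewrite leNgt; apply/negP => w_lt2; have : w ^+ 2 < 4 by have := w_gt0; nra.
  by rewrite w2; lra.
rewrite /cw_sum (eq_bigr (fun sigma => spin_prod R S sigma *
    expR (q * (mag R sigma / w) ^+ 2 / 2))); last by move=> sigma _; rewrite qE.
have E x : \sum_sigma spin_prod R S sigma * expR (mag R sigma / w * x) =
    \sum_sigma spin_prod R S sigma * expR (x / w * mag R sigma).
  by apply: eq_bigr => sigma _; congr (_ * expR _); ring.
apply: gauss_transform_ge => // x.
  by rewrite E mulr_ge0 ?expR_ge0// sum_spin_prod_exp_ge0// cS odd_double.
move=> x12; have /andP[x1 x2] := x12.
have u0 : 0 <= x / w by rewrite divr_ge0 ?ltW//; lra.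
have u01 : 0 <= x / w <= 1 by rewrite u0 ler_pdivrMr//; lra.
rewrite E; apply: (le_trans _ (ler_wpM2l (expR_ge0 _) (sum_spin_prod_exp_ge S u01))).
have u2 : ((4 * r) ^+ k)^-1 <= (x / w / 2) ^+ #|S|.
  rewrite cS -mul2n exprM -exprVn lerXn2r ?nnegrE ?sqr_ge0 ?invr_ge0 ?mulr_ge0 ?(ltW r_gt0)//.
  rewrite -w2 (_ : x / w / 2 = x / (2 * w)); last by field; rewrite gt_eqF.
  rewrite expr_div_n exprMn (_ : 2 ^+ 2 = 4); last by rewrite -natrX.
  rewrite -[leLHS]mul1r ler_wpM2r ?invr_ge0 ?mulr_ge0 ?sqr_ge0//; nra.
have := weight_ch_ge w_gt0 w2 nE lambda_lt r_ge1 x12; rewrite -/q => f1.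
rewrite [leRHS]mulrA ler_pM//.
  by rewrite invr_ge0 exprn_ge0// mulr_ge0 ?(ltW r_gt0).
by rewrite exprMn [leRHS]mulrCA ler_wpM2l ?exprn_ge0.
Qed.

End CurieWeissBounds.

Lemma ex_sqrt_natr_ge (R : realType) (M : R) :
  exists N, forall n, (N <= n)%N -> M <= Num.sqrt n%:R.
Proof.
exists (Num.truncn (M ^+ 2)).+1 => n Nn.
rewrite (le_trans (ler_norm M))// -sqrtr_sqr ler_wsqrtr//.
by rewrite ltW// (lt_le_trans (truncnS_gt _))// ler_nat.
Qed.

(** The Gaussian masses, the factor [4 ^+ n] and the power [r ^- k] appear both in the upper bound
    and in the product of the two lower bounds, and cancel. Hence [K] comes before [h], and only the
    threshold on [n] depends on [h]. *)
Lemma cw_overlap_ratio_le (R : realType) (lambda : R) (k : nat) :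
  exists2 K : R, 0 < K & forall h : R, 0 <= h -> exists N : nat,
  forall n, (N <= n)%N -> forall S : {set 'I_n}, #|S| = k.*2 ->
  let d := dn n lambda in
  [/\ 0 < cw_sum S d, 0 < cw_sum (finset.set0 : {set 'I_n}) d &
    cw_overlap S d (h / Num.sqrt n%:R) <=
    K * expR (101 * h ^+ 2) * (cw_sum S d * cw_sum (finset.set0 : {set 'I_n}) d)].
Proof.
pose D : R := 4 + 2 * `|lambda| + 4 * lambda ^+ 2.
pose a : R := `|lambda| / 2 + 2.
exists (8 ^+ k * k`!%:R * pi * expR (2 * D + 400 * a ^+ 2)).
  by rewrite !mulr_gt0 ?expR_gt0 ?pi_gt0 ?exprn_gt0// ltr0n fact_gt0.
move=> h h0.
have [N rN] := ex_sqrt_natr_ge (4 * (`|lambda| / 2 + h / 2 + 2)).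
exists N => n Nn S cS d; have := rN n Nn; set r := Num.sqrt _ => rB.
have l0 := normr_ge0 lambda.
have lr : `|lambda| * 2 <= r by lra.
have r4 : 4 <= r by lra.
have r1 : 1 <= r by lra.
have r0 : 0 < r by lra.
have VS := cw_sum_ge lr r1 cS r4.
have V0 := @cw_sum_ge R lambda n lr r1 finset.set0 0 (cards0 _) r4.
have U := cw_overlap_le lr r1 cS h0 rB.
rewrite -/d -/D -/r expr0 divr1 in VS V0 U.
set m := gauss_mass _ in VS V0 U.
have m0 : 0 < m.
  have w0 : 0 < Num.sqrt r by rewrite sqrtr_gt0.
  by apply/gauss_mass_gt0/(field_var_gt0 w0) => //; rewrite sqr_sqrtr// ltW.
have lS0 : 0 < 2 ^+ n * expR (- D) / (4 * r) ^+ k.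
  by rewrite divr_gt0 ?mulr_gt0 ?exprn_gt0 ?expR_gt0 ?mulr_gt0.
have l00 : 0 < 2 ^+ n * expR (- D) by rewrite mulr_gt0 ?exprn_gt0 ?expR_gt0.
split.
- by have := lt_le_trans lS0 VS; rewrite pmulr_rgt0.
- by have := lt_le_trans l00 V0; rewrite pmulr_rgt0.
rewrite -(ler_pM2l (exprn_gt0 2 m0)) (le_trans U)//.
have VV := ler_pM (ltW lS0) (ltW l00) VS V0.
pose K := 8 ^+ k * k`!%:R * pi * expR (2 * D + 400 * a ^+ 2) * expR (101 * h ^+ 2).
have K0 : 0 <= K by rewrite !mulr_ge0 ?expR_ge0 ?pi_ge0 ?exprn_ge0.
apply: (le_trans _ (le_trans (ler_wpM2l K0 VV) _)); last first.
  by rewrite le_eqVlt; apply/orP; left; apply/eqP; rewrite /K; ring.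
have -> : 4 ^+ n * expR (h ^+ 2 / 2) * ((2 / r) ^+ k * k`!%:R) *
     expR (100 * (`|lambda| / 2 + h / 2 + 2) ^+ 2) ^+ 2 * pi =
  8 ^+ k * k`!%:R * pi * (4 ^+ n / (4 * r) ^+ k) *
  (expR (h ^+ 2 / 2) * expR (100 * (`|lambda| / 2 + h / 2 + 2) ^+ 2) ^+ 2).
  rewrite (_ : (2 / r) ^+ k = 8 ^+ k / (4 * r) ^+ k); first by ring.
  by rewrite -expr_div_n; congr (_ ^+ k); field; exact: lt0r_neq0.
have -> : K * (2 ^+ n * expR (- D) / (4 * r) ^+ k * (2 ^+ n * expR (- D))) =
  8 ^+ k * k`!%:R * pi * (4 ^+ n / (4 * r) ^+ k) *
  (expR (2 * D + 400 * a ^+ 2) * expR (101 * h ^+ 2) * expR (- D) ^+ 2).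
  have -> : 4 ^+ n = 2 ^+ n * 2 ^+ n :> R by rewrite -exprMn -natrM.
  rewrite /K; move: (2 ^+ n) ((4 * r) ^- k) => A1 A2.
  ring.
apply: ler_wpM2l.
  apply: mulr_ge0; first by rewrite !mulr_ge0 ?pi_ge0 ?exprn_ge0.
  by rewrite divr_ge0 ?exprn_ge0// mulr_ge0// ltW.
rewrite -!expRM_natl -!expRD ler_expR.
(* From [(a + h / 2) ^+ 2 <= 2 * a ^+ 2 + h ^+ 2 / 2], the exponent is at most 400 a^2 + (100 + 1/2)
   h^2, which explains the constants 400 and 101. *)
have := sqr_ge0 (a - h / 2); rewrite /a; nra.
Qed.

(** * Currents and spins *)

Section SpinCurrents.
Variables (R : realType) (n : nat).
Implicit Types (sigma tau eta : {ffun 'I_n -> bool}) (S : {set 'I_n}).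
Implicit Types (m : current n) (d s : R).

Let E sigma (e : edge n) : R := spin_prod R (val e) sigma.

(** Ordered pairs off the diagonal are grouped by their underlying two-element set; each edge comes
    from two of them. *)
Lemma sqr_sum_edges (x : 'I_n -> R) :
  (\sum_i x i) ^+ 2 =
  \sum_i x i ^+ 2 + 2 * \sum_(e : edge n) \prod_(i in val e) x i.
Proof.
have -> : \sum_(e : edge n) \prod_(i in val e) x i =
    \sum_(A : {set 'I_n} | #|A| == 2%N) \prod_(i in A) x i.
  rewrite [RHS](reindex_omap (val : edge n -> {set 'I_n}) insub)/=.
    by apply: eq_bigl => e; rewrite (valP e) valK eqxx.
  by move=> A cA; rewrite insubT.
rewrite expr2 big_distrlr/= pair_big/= (bigID (fun p => p.1 == p.2))/=.
congr (_ + _).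
  rewrite (reindex_onto (fun i => (i, i)) fst)/=; last first.
    by move=> [i j] /= /eqP ->.
  by apply: eq_big => [i|i _]; rewrite ?eqxx.
rewrite (partition_big (fun p => [set p.1; p.2]%SET) (fun A => #|A| == 2%N))/=; last first.
  by move=> p np; rewrite cards2 np.
rewrite mulr_sumr; apply: eq_bigr => A /cards2P [i [j [ij ->]]].
rewrite big_setU1/= ?big_set1 ?inE//.
rewrite (bigD1 (i, j))/=; last by rewrite ij eqxx.
rewrite (bigD1 (j, i))/=; last first.
  by rewrite eq_sym ij finset.setUC eqxx/= xpair_eqE negb_and eq_sym ij.
rewrite big1 ?addr0; first by ring.
move=> [a b] /= /andP[/andP[/andP[ab /eqP abE] n1] n2]; exfalso.
move: n1 n2; rewrite !xpair_eqE !negb_and.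
have : a \in [set i; j]%SET by rewrite -abE !inE eqxx.
have : b \in [set i; j]%SET by rewrite -abE !inE eqxx orbT.
by rewrite !inE => /orP[] /eqP bE /orP[] /eqP aE; move: ab; rewrite aE bE ?eqxx.
Qed.

Lemma spin_sqr sigma i : spin R sigma i ^+ 2 = 1.
Proof. by rewrite /spin sqrr_sign. Qed.

Lemma sum_spin_edges sigma :
  \sum_e E sigma e = (mag R sigma ^+ 2 - n%:R) / 2.
Proof.
rewrite /mag sqr_sum_edges.
under [X in X + _ - _]eq_bigr do rewrite spin_sqr.
by rewrite sumr_const card_ord /E /spin_prod; field.
Qed.

(* The average over spins kills every vertex whose degree parity does not match
   [S]. *)
Lemma sum_spin_prod_current S m :
  \sum_sigma spin_prod R S sigma * \prod_e E sigma e ^+ m e =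
  if sources m == S then 2 ^+ n else 0.
Proof.
pose deg i := (\sum_(e : edge n | i \in val e) m e)%N.
pose F i (b : bool) : R := (if i \in S then (-1) ^+ b else 1) * ((-1) ^+ b) ^+ deg i.
transitivity (\sum_(sigma : {ffun 'I_n -> bool}) \prod_i F i (sigma i)).
  apply: eq_bigr => sigma _; rewrite /F big_split/= spin_prod_mkcond.
  congr (_ * _).
  transitivity (\prod_(e : edge n) \prod_i (if i \in val e then spin R sigma i ^+ m e else 1)).
    by apply: eq_bigr => e _; rewrite /E /spin_prod -prodrXl big_mkcond.
  rewrite exchange_big/=; apply: eq_bigr => i _.
  by rewrite -big_mkcond prodrXr.
rewrite sum_prod_spins.
have FE i : F i true + F i false = if odd (deg i) == (i \in S) then 2 else 0.
  rewrite /F /= expr0 expr1 expr1n -signr_odd.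
  by case: (odd _); case: (i \in S); rewrite /= ?expr0 ?expr1; ring.
under eq_bigr do rewrite FE.
case: ifPn => [/eqP SE|SN].
  rewrite (eq_bigr (fun=> 2)) ?prodr_const ?card_ord// => i _.
  by rewrite -SE inE eqxx.
have [i] : exists i, odd (deg i) != (i \in S).
  apply/existsP; rewrite -negb_forall; apply: contra SN => /forallP h.
  by apply/eqP/finset.setP => i; rewrite finset.in_set; exact/eqP/h.
by move=> /negPf iN; rewrite (bigD1 i)//= iN mul0r.
Qed.

Definition spin_mul sigma eta : {ffun 'I_n -> bool} :=
  [ffun i => sigma i (+) eta i].

Lemma spin_mulE sigma eta i :
  spin R (spin_mul sigma eta) i = spin R sigma i * spin R eta i.
Proof. by rewrite /spin ffunE signr_addb. Qed.

Lemma spin_mulK sigma : involutive (spin_mul sigma).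
Proof. by move=> eta; apply/ffunP => i; rewrite !ffunE addKb. Qed.

Lemma spin_prod_mul S sigma eta :
  spin_prod R S (spin_mul sigma eta) = spin_prod R S sigma * spin_prod R S eta.
Proof. by rewrite -big_split/=; apply: eq_bigr => i _; rewrite spin_mulE. Qed.

Lemma sum_spin_mul (f : {ffun 'I_n -> bool} -> R) sigma :
  \sum_tau f tau = \sum_eta f (spin_mul sigma eta).
Proof. by rewrite (reindex_inj (inv_inj (spin_mulK sigma))). Qed.

(** The term of [m] when the exponential of the sum of the [a e] is expanded edge by edge; for [a]
    constantly [dn n lambda] it is [weight]. *)
Definition current_coef (a : edge n -> R) m : R :=
  \prod_e (a e ^+ m e / (m e)`!%:R).

Lemma current_coefM (a b : edge n -> R) m :
  current_coef (fun e => a e * b e) m = \prod_e a e ^+ m e * current_coef b m.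
Proof.
by rewrite /current_coef -big_split/=; apply: eq_bigr => e _; rewrite exprMn mulrA.
Qed.

(** The share of [m] in the expansion of the two-replica sum; at [s = 0] it is, up to a constant,
    the law of the double current. *)
Definition double_coef S d s m : R :=
  \sum_sigma \sum_tau spin_prod R S sigma * expR (s * overlap R sigma tau) *
    current_coef (fun e => d * E sigma e + d * E tau e) m.

(** The joint weight of the relative signs and the current: [1 + E eta e] is 0 if the signs disagree
    along [e] and 2 if they agree. *)
Definition agree_coef d eta m : R := current_coef (fun e => d * (1 + E eta e)) m.

(** Substituting [tau = spin_mul sigma eta] turns the overlap into the magnetization of [eta] and
    frees [sigma], whose sum only tests the sources of [m]. *)
Lemma double_coefE S d s m : double_coef S d s m =
  (if sources m == S then 2 ^+ n else 0) *
  \sum_eta expR (s * mag R eta) * agree_coef d eta m.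
Proof.
rewrite -sum_spin_prod_current mulr_suml; apply: eq_bigr => sigma _.
rewrite (sum_spin_mul _ sigma) mulr_sumr; apply: eq_bigr => eta _.
have -> : overlap R sigma (spin_mul sigma eta) = mag R eta.
  by apply: eq_bigr => i _; rewrite spin_mulE mulrA -expr2 spin_sqr mul1r.
have -> : (fun e => d * E sigma e + d * E (spin_mul sigma eta) e) =
    (fun e => E sigma e * (d * (1 + E eta e))).
  by apply/funext => e; rewrite /E spin_prod_mul; ring.
rewrite current_coefM /agree_coef; ring.
Qed.

Lemma edge_spin_ge eta e : -1 <= E eta e.
Proof.
have : `|E eta e| <= 1.
  rewrite /E /spin_prod normr_prod big1// => i _.
  by rewrite /spin normrX normrN1 expr1n.
by rewrite ler_norml => /andP[].
Qed.

Lemma agree_coef_ge0 d eta m : 0 <= d -> 0 <= agree_coef d eta m.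
Proof.
move=> d0; apply: prodr_ge0 => e _; rewrite divr_ge0// exprn_ge0// mulr_ge0//.
by have := edge_spin_ge eta e; lra.
Qed.

Definition flip (A : {set 'I_n}) : {ffun 'I_n -> bool} := [ffun i => i \in A].

Lemma spin_flip A i : spin R (flip A) i = if i \in A then -1 else 1.
Proof. by rewrite /spin ffunE; case: ifP => _; rewrite ?expr1 ?expr0. Qed.

(* Flipping a union of clusters changes no spin product along an open edge. *)
Lemma agree_coef_flip (A : {set 'I_n}) d eta m :
  (forall e, (0 < m e)%N -> (val e \subset A) || [disjoint val e & A]) ->
  agree_coef d (spin_mul (flip A) eta) m = agree_coef d eta m.
Proof.
move=> mA; apply: eq_bigr => e _.
have [->|m0] := posnP (m e); first by rewrite !expr0.
rewrite /E spin_prod_mul; suff -> : spin_prod R (val e) (flip A) = 1 by rewrite mul1r.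
rewrite /spin_prod; have /orP[eA|eA] := mA e m0.
  rewrite (eq_bigr (fun=> -1)) ?prodr_const ?(eqP (valP e)) ?sqrrN ?expr1n//.
  by move=> i ie; rewrite spin_flip (fintype.subsetP eA).
rewrite big1// => i ie; rewrite spin_flip.
by rewrite (disjointFr eA).
Qed.

Lemma connected_inE m (x y : 'I_n) :
  connected_in m x y = connect (open_edge m) x y.
Proof.
apply/existsP/idP => [[i /existsP[j /and3P[/eqP ix /eqP jy]]]|xy].
  by rewrite (val_inj ix) (val_inj jy).
by exists x; apply/existsP; exists y; rewrite !eqxx.
Qed.

Lemma open_edge_sym m : symmetric (open_edge m).
Proof. by move=> x y; apply: eq_existsb => e; rewrite finset.setUC. Qed.

Lemma ccluster_closed m (x : 'I_n) (e : edge n) : (0 < m e)%N ->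
  (val e \subset ccluster m x) || [disjoint val e & ccluster m x].
Proof.
move=> me; have /cards2P[a [b [ab eE]]] := valP e.
have oe : open_edge m a b by apply/existsP; exists e; rewrite eE eqxx me.
have ob : open_edge m b a by rewrite open_edge_sym.
have abC : (a \in ccluster m x) = (b \in ccluster m x).
  rewrite !inE !connected_inE.
  by apply/idP/idP => /connect_trans; apply; exact: connect1.
rewrite eE; case: (boolP (a \in ccluster m x)) => aC.
  by rewrite finset.subUset !finset.sub1set -abC aC.
apply/orP; right; apply/pred0P => z /=; rewrite finset.in_set2.
have [->|_] := eqVneq z a; first by rewrite (negPf aC).
by have [->|//] := eqVneq z b; rewrite -abC (negPf aC).
Qed.

Lemma spin_pm1 eta i : spin R eta i = 1 \/ spin R eta i = -1.
Proof. by rewrite /spin; case: (eta i); [right; rewrite expr1|left; rewrite expr0]. Qed.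

(** An open edge along which the signs disagree would contribute a zero factor. *)
Lemma agree_coef_cst d eta m (x y : 'I_n) : agree_coef d eta m != 0 ->
  y \in ccluster m x -> spin R eta y = spin R eta x.
Proof.
move=> m0; rewrite inE connected_inE => xy.
have cl : fingraph.closed (open_edge m) [pred z | spin R eta z == spin R eta x].
  move=> a b /existsP[e /andP[/eqP eE me]]; rewrite !inE.
  suff -> : spin R eta a = spin R eta b by [].
  apply/eqP; apply: contra_neqT m0 => ab.
  rewrite /agree_coef /current_coef (bigD1 e)//=.
  have aNb : a \notin [set b]%SET by rewrite inE; apply: contraNneq ab => ->.
  have -> : E eta e = -1.
    rewrite /E /spin_prod eE big_setU1//= big_set1.
    by move: ab; case: (spin_pm1 eta a) => ->; case: (spin_pm1 eta b) => ->;
      rewrite ?eqxx// => _; ring.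
  by rewrite subrr mulr0 expr0n gtn_eqF// !mul0r.
by have := closed_connect cl xy; rewrite !inE eqxx => /esym/eqP.
Qed.

Lemma mag_flip (A : {set 'I_n}) eta : mag R (spin_mul (flip A) eta) =
  \sum_(i in ~: A) spin R eta i - \sum_(i in A) spin R eta i.
Proof.
rewrite /mag (bigID (mem A))/= addrC -sumrN; congr (_ + _).
  apply: eq_big => [i|i iA]; first by rewrite inE.
  by rewrite spin_mulE spin_flip (negPf iA) mul1r.
by apply: eq_bigr => i iA; rewrite spin_mulE spin_flip iA mulN1r.
Qed.

(** Let [a] and [b] be the sums of the signs over the cluster and its complement. The weight is
    invariant under flipping either or both, so the exponential averages to
    [ch (s * a) * ch (s * b)]. Where the weight is nonzero the signs are constant on the cluster, so
    [a] is its cardinality up to sign; the second factor is at least 1. *)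
Lemma ccluster_ch_le d s m (x : 'I_n) : 0 <= d ->
  ch (s * #|ccluster m x|%:R) * \sum_eta agree_coef d eta m <=
  \sum_eta expR (s * mag R eta) * agree_coef d eta m.
Proof.
move=> d0; set C := ccluster m x.
pose a eta := \sum_(i in C) spin R eta i.
pose b eta := \sum_(i in ~: C) spin R eta i.
have flipE (A : {set 'I_n}) :
    (forall e, (0 < m e)%N -> (val e \subset A) || [disjoint val e & A]) ->
    \sum_eta expR (s * mag R eta) * agree_coef d eta m =
    \sum_eta expR (s * mag R (spin_mul (flip A) eta)) * agree_coef d eta m.
  move=> mA; rewrite (sum_spin_mul _ (flip A)); apply: eq_bigr => eta _.
  by rewrite agree_coef_flip.
have mC := @ccluster_closed m x.
have mCC e : (0 < m e)%N -> (val e \subset ~: C) || [disjoint val e & ~: C].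
  move=> /mC mCe; rewrite finset.disjoints_subset finset.setCK orbC.
  by rewrite -finset.disjoints_subset.
have mT e : (0 < m e)%N ->
    (val e \subset [set: 'I_n]%SET) || [disjoint val e & [set: 'I_n]%SET].
  by rewrite finset.subsetT.
set T := \sum_eta expR (s * mag R eta) * _.
have T4 : 4 * T = \sum_eta 4 * ch (s * a eta) * ch (s * b eta) * agree_coef d eta m.
  have -> : 4 * T = T + T + (T + T) by ring.
  rewrite {2}/T (flipE _ mC) {2}/T (flipE _ mCC) {2}/T (flipE _ mT) /T -!big_split/=.
  apply: eq_bigr => eta _; rewrite !mag_flip finset.setCK finset.setCT big_set0.
  have magE : mag R eta = a eta + b eta.
    rewrite /mag (bigID (mem C))/=; congr (_ + _).
    by rewrite /b; apply: eq_bigl => i; rewrite finset.in_setC.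
  have -> : \sum_(i in [set: 'I_n]%SET) spin R eta i = mag R eta.
    by apply: eq_bigl => i; rewrite inE.
  rewrite sub0r magE -/C -/(a eta) -/(b eta) !(mulrBr s) (mulrN s) !(mulrDr s) opprD.
  rewrite !expRD /ch.
  by field.
rewrite -(@ler_pM2l _ 4)// T4 !mulr_sumr; apply: ler_sum => eta _.
rewrite -!(mulrA 4) -(mulrA (ch (s * a eta))) ler_wpM2l//.
have [->|ag0] := eqVneq (agree_coef d eta m) 0; first by rewrite !mulr0.
have -> : ch (s * a eta) = ch (s * #|C|%:R).
  have -> : a eta = #|C|%:R * spin R eta x.
    rewrite /a (eq_bigr (fun=> spin R eta x)) => [|i]; last exact: (agree_coef_cst ag0).
    by rewrite sumr_const mulr_natl.
  by case: (spin_pm1 eta x) => ->; rewrite ?mulr1// mulrN1 mulrN chN.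
rewrite ler_wpM2l ?ch_ge0// ler_peMl ?ch_ge1//; exact: agree_coef_ge0.
Qed.

Lemma double_coef_ch_le S d s m (x : 'I_n) : 0 <= d ->
  ch (s * #|ccluster m x|%:R) * double_coef S d 0 m <= double_coef S d s m.
Proof.
move=> d0; rewrite !double_coefE mulrCA ler_wpM2l//; first by case: ifP.
have := ccluster_ch_le s m x d0.
by under [X in _ -> _ * X <= _]eq_bigr do rewrite mul0r expR0 mul1r.
Qed.

(** Currents with all values below [L] form a finite type; sums over all currents are reached as
    limits in [L]. *)
Definition bounded_current L (f : {ffun edge n -> 'I_L}) : current n :=
  [ffun e => f e : nat].

Definition subc m1 m2 : current n := [ffun e => (m1 e - m2 e)%N].

Definition lec m1 m2 := [forall e, (m1 e <= m2 e)%N].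

(** The binomial formula over a range independent of [j], so that a product over edges distributes
    into a sum over functions to ['I_L]. *)
Lemma exprD_fact_trunc (a b : R) j L : (j < L)%N ->
  (a + b) ^+ j / j`!%:R =
  \sum_(i < L) if (i <= j)%N then a ^+ i / i`!%:R * (b ^+ (j - i) / (j - i)`!%:R)
               else 0.
Proof.
move=> jL; rewrite -big_mkcond/=.
rewrite -(big_ord_widen _ (fun i => a ^+ i / i`!%:R * (b ^+ (j - i) / (j - i)`!%:R)) jL).
rewrite addrC exprDn mulr_suml; apply: eq_bigr => i _.
have ij : (i <= j)%N by rewrite -ltnS.
have fact_neq0 k : k`!%:R != 0 :> R by rewrite pnatr_eq0 -lt0n fact_gt0.
rewrite -(bin_fact ij) !natrM -mulr_natr; field.
by rewrite !fact_neq0 pnatr_eq0 -lt0n bin_gt0.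
Qed.

Lemma current_coefMs d sigma m :
  current_coef (fun e => d * E sigma e) m =
  current_coef (fun=> d) m * \prod_e E sigma e ^+ m e.
Proof.
by rewrite mulrC -current_coefM; congr current_coef; apply/funext => e; rewrite mulrC.
Qed.

(** Expanding each power of a sum over the two replicas splits [m] into [f] and a remainder. At
    [s = 0] the two spin sums decouple, one imposing the sources [S] on [f], the other an empty
    source set on the remainder. *)
Lemma double_coef_split L S d (g : {ffun edge n -> 'I_L}) :
  let m := bounded_current g in
  double_coef S d 0 m =
  \sum_(f : {ffun edge n -> 'I_L} | lec (bounded_current f) m)
     (if sources (bounded_current f) == S then 2 ^+ n else 0) *
     (if sources (subc m (bounded_current f)) == finset.set0 then 2 ^+ n else 0) *
     (current_coef (fun=> d) (bounded_current f) *
      current_coef (fun=> d) (subc m (bounded_current f))).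
Proof.
move=> m; pose a sigma e := d * E sigma e.
have split_coef sigma tau :
    current_coef (fun e => a sigma e + a tau e) m =
    \sum_(f : {ffun edge n -> 'I_L} | lec (bounded_current f) m)
      current_coef (a sigma) (bounded_current f) *
      current_coef (a tau) (subc m (bounded_current f)).
  rewrite /current_coef (eq_bigr (fun e => \sum_(i < L) if (i <= m e)%N then
      a sigma e ^+ i / i`!%:R * (a tau e ^+ (m e - i) / (m e - i)`!%:R) else 0)).
    rewrite bigA_distr_bigA/= [RHS]big_mkcond/=; apply: eq_bigr => f _.
    case: ifPn => [/forallP fm|].
      rewrite -big_split/=; apply: eq_bigr => e _.
      by have := fm e; rewrite !ffunE => ->.
    rewrite negb_forall => /existsP[e]; rewrite ffunE => fm.
    by rewrite (bigD1 e)//= (negPf fm) mul0r.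
  by move=> e _; apply: exprD_fact_trunc; rewrite ffunE.
rewrite /double_coef (eq_bigr (fun sigma => \sum_(f : {ffun edge n -> 'I_L} |
    lec (bounded_current f) m) \sum_tau spin_prod R S sigma *
    (current_coef (a sigma) (bounded_current f) *
      current_coef (a tau) (subc m (bounded_current f))))); last first.
  move=> sigma _; rewrite exchange_big/=; apply: eq_bigr => tau _.
  by rewrite mul0r expR0 mulr1 split_coef mulr_sumr.
rewrite exchange_big/=; apply: eq_bigr => f _.
rewrite -!sum_spin_prod_current mulr_suml mulr_suml; apply: eq_bigr => sigma _.
rewrite mulr_sumr mulr_suml; apply: eq_bigr => tau _.
rewrite /a !current_coefMs [spin_prod R finset.set0 tau]big_set0; ring.
Qed.

Lemma sum_bounded_coef L (a : edge n -> R) :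
  \sum_(f : {ffun edge n -> 'I_L}) current_coef a (bounded_current f) =
  \prod_e \sum_(j < L) a e ^+ j / j`!%:R.
Proof.
rewrite bigA_distr_bigA/=; apply: eq_bigr => f _; apply: eq_bigr => e _.
by rewrite ffunE.
Qed.

Lemma cvg_bounded_coef (a : edge n -> R) :
  (fun L => \sum_(f : {ffun edge n -> 'I_L}) current_coef a (bounded_current f))
    @ \oo --> expR (\sum_e a e).
Proof.
under eq_fun do rewrite sum_bounded_coef.
rewrite expR_sum; set l := index_enum _; clearbody l.
suff : (fun L => \prod_(e <- l) \sum_(j < L) a e ^+ j / j`!%:R) @ \oo -->
    \prod_(e <- l) expR (a e) by [].
elim: l => [|e l IH].
  by rewrite big_nil; under eq_cvg do rewrite big_nil; exact: cvg_cst.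
rewrite big_cons; under eq_cvg do rewrite big_cons.
apply: cvgM IH; have := @is_cvg_series_exp_coeff R (a e).
by rewrite /expR /series/=; under eq_fun do rewrite big_mkord.
Qed.

End SpinCurrents.

(** * Partition functions as limits over bounded currents *)

Lemma cvg_sum_fintype (R : realType) (I : finType) (f : I -> nat -> R) (l : I -> R) :
  (forall i, f i @ \oo --> l i) ->
  (fun L => \sum_i f i L) @ \oo --> \sum_i l i.
Proof.
move=> fl; set r := index_enum _; clearbody r.
suff : (fun L => \sum_(i <- r) f i L) @ \oo --> \sum_(i <- r) l i by [].
elim: r => [|i r IH].
  by rewrite big_nil; under eq_cvg do rewrite big_nil; exact: cvg_cst.
rewrite big_cons; under eq_cvg do rewrite big_cons.
exact: cvgD.
Qed.

Section PartitionFunctions.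
Variables (R : realType) (n : nat) (lambda : R).
Implicit Types (S : {set 'I_n}) (s : R).
Let d := dn n lambda.

Lemma sum_edges_coupling (sigma : {ffun 'I_n -> bool}) :
  \sum_(e : edge n) d * spin_prod R (val e) sigma =
  - (d * n%:R / 2) + d * mag R sigma ^+ 2 / 2.
Proof. by rewrite -mulr_sumr sum_spin_edges; field. Qed.

(** The spin average selects the currents with sources [S], and resumming over currents restores the
    Boltzmann factor. The constant [- (d * n%:R / 2)] is the diagonal part of the squared
    magnetization. *)
Lemma cvg_bounded_weight S :
  (fun L => \sum_(f : {ffun edge n -> 'I_L} | sources (bounded_current f) == S)
     weight lambda (bounded_current f)) @ \oo -->
  (2 ^+ n)^-1 * (expR (- (d * n%:R / 2)) * cw_sum S d).
Proof.
have -> : expR (- (d * n%:R / 2)) * cw_sum S d = \sum_sigma spin_prod R S sigma *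
    expR (\sum_(e : edge n) d * spin_prod R (val e) sigma).
  rewrite mulr_sumr; apply: eq_bigr => sigma _.
  by rewrite sum_edges_coupling expRD mulrCA.
rewrite [X in X @ _ --> _](_ : _ = fun L => (2 ^+ n)^-1 *
    \sum_sigma spin_prod R S sigma * \sum_(f : {ffun edge n -> 'I_L})
      current_coef (fun e => d * spin_prod R (val e) sigma) (bounded_current f)).
  apply: cvgMr; apply: cvg_sum_fintype => sigma.
  by apply: cvgMr; exact: cvg_bounded_coef.
apply/funext => L; rewrite (eq_bigr (fun sigma => \sum_(f : {ffun edge n -> 'I_L})
    spin_prod R S sigma * current_coef (fun e => d * spin_prod R (val e) sigma)
      (bounded_current f))); last by move=> sigma _; rewrite mulr_sumr.
rewrite exchange_big/= mulr_sumr big_mkcond/=; apply: eq_bigr => f _.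
rewrite (eq_bigr (fun sigma => current_coef (fun=> d) (bounded_current f) *
   (spin_prod R S sigma *
    \prod_e spin_prod R (val e) sigma ^+ (bounded_current f) e))); last first.
  by move=> sigma _; rewrite current_coefMs mulrCA.
rewrite -mulr_sumr sum_spin_prod_current; case: ifP => _; last by rewrite !mulr0.
by rewrite mulrCA mulVf ?mulr1// expf_neq0.
Qed.

Lemma cvg_bounded_double_coef S s :
  (fun L => \sum_(f : {ffun edge n -> 'I_L}) double_coef S d s (bounded_current f))
    @ \oo --> expR (- (d * n%:R)) * cw_overlap S d s.
Proof.
rewrite /double_coef /cw_overlap !pair_big/= mulr_sumr.
rewrite [X in X @ _ --> _](_ : _ = fun L => \sum_(p : {ffun 'I_n -> bool} * {ffun 'I_n -> bool})
    spin_prod R S p.1 * expR (s * overlap R p.1 p.2) *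
    \sum_(f : {ffun edge n -> 'I_L})
      current_coef (fun e => d * spin_prod R (val e) p.1 + d * spin_prod R (val e) p.2)
        (bounded_current f)); last first.
  apply/funext => L; under eq_bigr do rewrite pair_big/=.
  rewrite exchange_big/=; by apply: eq_bigr => p _; rewrite [RHS]mulr_sumr.
apply: cvg_sum_fintype => p; rewrite mulrCA; apply: cvgMr.
rewrite -expRD (_ : _ + _ = \sum_(e : edge n) (d * spin_prod R (val e) p.1 +
    d * spin_prod R (val e) p.2)); first exact: cvg_bounded_coef.
by rewrite big_split/= !sum_edges_coupling; field.
Qed.

End PartitionFunctions.

(** * Events and laws of random currents *)

Lemma measure_finType_bigcup (R : realType) (dT : measure_display)
    (T : measurableType dT) (P : probability T R) (I : finType) (Q : pred I)
    (F : I -> set T) :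
  (forall i, measurable (F i)) -> (forall i j w, F i w -> F j w -> i = j) ->
  P (\bigcup_(i in [set i | Q i]) F i) = (\sum_(i | Q i) P (F i))%E.
Proof.
move=> mF dF; rewrite measure_fin_bigcup//.
- have -> : [set i | Q i] = [set` enum Q].
    by apply/seteqP; split => i /=; rewrite mem_enum.
  by rewrite -fsbig_seq ?enum_uniq// big_enum.
- exact: finite_finset.
- by move=> i j _ _ [w [Fi Fj]]; exact: dF Fi Fj.
Qed.

Section CurrentLaw.
Variables (R : realType) (dT : measure_display) (T : measurableType dT).
Variables (P : probability T R) (n : nat).

Lemma bounded_current_inj L : injective (@bounded_current n L).
Proof.
move=> f g fg; apply/ffunP => e; apply/val_inj.
by have := congr1 (fun m : current n => m e) fg; rewrite !ffunE.
Qed.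

Definition bounded_by L (m : current n) := [forall e, (m e < L)%N].

Lemma bounded_byP L m :
  bounded_by L m -> exists f : {ffun edge n -> 'I_L}, m = bounded_current f.
Proof.
move=> /forallP mL; exists [ffun e => Ordinal (mL e)].
by apply/ffunP => e; rewrite !ffunE.
Qed.

Lemma bounded_by_bounded L (f : {ffun edge n -> 'I_L}) : bounded_by L (bounded_current f).
Proof. by apply/forallP => e; rewrite ffunE. Qed.

Lemma prob_bounded (Y : T -> current n) (Q : pred (current n)) L :
  (forall m, measurable (Y @^-1` [set m])) ->
  P [set w | bounded_by L (Y w) && Q (Y w)] =
  (\sum_(f : {ffun edge n -> 'I_L} | Q (bounded_current f))
     P (Y @^-1` [set bounded_current f]))%E.
Proof.
move=> mY; rewrite -measure_finType_bigcup//; last first.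
  by move=> f g w /= -> /bounded_current_inj.
congr (P _); apply/seteqP; split => w /=.
  by move=> /andP[/bounded_byP[f YE] QY]; exists f => //=; rewrite -YE.
by move=> [f /= Qf ->]; rewrite bounded_by_bounded.
Qed.

(** Currents are countable, so the event is a countable union of fibers. Working from fibers lets
    [Y] be a sum of two currents. *)
Lemma measurable_current_event (Y : T -> current n) (Q : pred (current n)) :
  (forall m, measurable (Y @^-1` [set m])) -> measurable [set w | Q (Y w)].
Proof.
move=> mY; pose F k : set T := if unpickle k is Some m then
  if Q m then Y @^-1` [set m] else set0 else set0.
rewrite (_ : [set w | _] = \bigcup_k F k).
  apply: bigcupT_measurable => k; rewrite /F.
  by case: unpickle => [m|] //; case: ifP.
apply/seteqP; split => w /=.
  by move=> QY; exists (pickle (Y w)) => //; rewrite /F pickleK QY.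
by move=> [k _]; rewrite /F; case: unpickle => [m|]//; case: ifP => // Qm /= ->.
Qed.

Lemma cvg_prob_bounded (Y : T -> current n) (Q : pred (current n)) :
  (forall m, measurable (Y @^-1` [set m])) ->
  (fun L => P [set w | bounded_by L (Y w) && Q (Y w)]) @ \oo -->
  P [set w | Q (Y w)].
Proof.
move=> mY; pose F L := [set w | bounded_by L (Y w) && Q (Y w)].
have mF L : measurable (F L).
  exact: (@measurable_current_event Y (fun m => bounded_by L m && Q m)).
have -> : [set w | Q (Y w)] = \bigcup_L F L.
  apply/seteqP; split => w /=; last by move=> [L _ /andP[]].
  move=> QY; exists (\max_(e : edge n) Y w e).+1 => //; rewrite /F/= QY andbT.
  by apply/forallP => e; rewrite ltnS leq_bigmax.
apply: nondecreasing_cvg_mu => //; first exact: bigcupT_measurable.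
move=> L1 L2 L12; apply/subsetPset => w /andP[/forallP b1 q]; apply/andP; split => //.
by apply/forallP => e; exact: leq_trans (b1 e) L12.
Qed.

End CurrentLaw.

(** * The double current *)

Section DoubleCurrentTail.
Variables (R : realType) (dT : measure_display) (T : measurableType dT).
Variables (P : probability T R) (n : nat) (lambda : R) (S : {set 'I_n}).
Let d := dn n lambda.
Hypothesis d_gt0 : 0 < d.
Let Zlim (S : {set 'I_n}) : R :=
  (2 ^+ n)^-1 * (expR (- (d * n%:R / 2)) * cw_sum S d).

Lemma measurable_current_fiber (X : {RV P >-> current n}) m :
  measurable (X @^-1` [set m]).
Proof. by rewrite -[X @^-1` _]setTI; exact: measurable_funPT. Qed.

(* The total mass of the law forces its normalization to be the Ising partition
   function, so that the [\esum] defining [Zn] need not be evaluated. *)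
Lemma current_law_normalization (A : {set 'I_n}) (X : {RV P >-> current n}) :
  (forall m, P (X @^-1` [set m]) = (current_prob lambda A m)%:E) ->
  (fine (Zn lambda A))^-1 * Zlim A = 1.
Proof.
move=> lawX; have mX := measurable_current_fiber X.
pose r L := (fine (Zn lambda A))^-1 *
  \sum_(f : {ffun edge n -> 'I_L} | sources (bounded_current f) == A)
    weight lambda (bounded_current f).
have rE L : P [set w | bounded_by L (X w) && xpredT (X w)] = (r L)%:E.
  rewrite (@prob_bounded R dT T P n X xpredT _ mX) /r mulr_sumr [X in _ = X%:E]big_mkcond/=.
  rewrite -sumEFin; apply: eq_bigr => f _.
  by rewrite lawX /current_prob mulrC; case: ifP.
have cR : r @ \oo --> (1 : R).
  have : (fun L => fine (P [set w | bounded_by L (X w) && xpredT (X w)])) @ \oo -->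
      (1 : R).
    apply: fine_cvg; rewrite -[1%:E](@probability_setT _ _ _ P).
    rewrite (_ : setT = [set w | xpredT (X w)]); last by apply/seteqP; split.
    exact: (@cvg_prob_bounded R dT T P n X xpredT mX).
  by under eq_cvg do rewrite rE.
apply: (cvg_unique _ _ cR) => //.
by apply: cvgMr; exact: cvg_bounded_weight.
Qed.

Variables (X1 X2 : {RV P >-> current n}).
Hypothesis law1 : forall m, P (X1 @^-1` [set m]) = (current_prob lambda S m)%:E.
Hypothesis law2 : forall m,
  P (X2 @^-1` [set m]) = (current_prob lambda finset.set0 m)%:E.
Hypothesis indep12 : independent_RV P X1 X2.
Let Y w := addc (X1 w) (X2 w).

Lemma double_current_fiberE L (g : {ffun edge n -> 'I_L}) :
  let m := bounded_current g in
  Y @^-1` [set m] = \bigcup_(f in [set f : {ffun edge n -> 'I_L} | lec (bounded_current f) m])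
    (X1 @^-1` [set bounded_current f] `&` X2 @^-1` [set subc m (bounded_current f)]).
Proof.
move=> m; apply/seteqP; split => w /=.
  move=> Ym; have le1 e : (X1 w e <= m e)%N by rewrite -Ym ffunE leq_addr.
  have [f X1f] : exists f : {ffun edge n -> 'I_L}, X1 w = bounded_current f.
    by apply: bounded_byP; apply/forallP => e; rewrite (leq_ltn_trans (le1 e))// ffunE.
  exists f => /=; first by apply/forallP => e; rewrite -X1f.
  split => //; apply/ffunP => e; rewrite [RHS]ffunE -X1f -Ym [in RHS]ffunE.
  by rewrite addKn.
move=> [f /= /forallP fm [X1f X2f]]; apply/ffunP => e.
by rewrite [LHS]ffunE X1f X2f [subc _ _ e]ffunE subnKC.
Qed.

Lemma measurable_double_current_fiber m : measurable (Y @^-1` [set m]).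
Proof.
have [f ->] : exists f : {ffun edge n -> 'I_(\max_e m e).+1}, m = bounded_current f.
  by apply: bounded_byP; apply/forallP => e; rewrite ltnS leq_bigmax.
rewrite double_current_fiberE; apply: fin_bigcup_measurable; first exact: finite_finset.
by move=> g _; apply: measurableI; exact: measurable_current_fiber.
Qed.

(** Independence makes each splitting a product of two laws; [double_coef_split] collects the
    splittings, and [4 ^+ n] undoes the two spin sums. *)
Lemma double_current_law L (g : {ffun edge n -> 'I_L}) :
  P (Y @^-1` [set bounded_current g]) =
  ((fine (Zn lambda S))^-1 * (fine (Zn lambda (finset.set0 : {set 'I_n})))^-1 *
   ((4 ^+ n)^-1 * double_coef S d 0 (bounded_current g)))%:E.
Proof.
rewrite double_current_fiberE measure_finType_bigcup; last 2 first.
- by move=> f; apply: measurableI; exact: measurable_current_fiber.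
- by move=> f h w /= [X1f _] [X1h _]; apply: (@bounded_current_inj n L); rewrite -X1f.
rewrite double_coef_split !mulr_sumr -sumEFin; apply: eq_bigr => f _.
rewrite indep12// law1 law2 -EFinM; congr EFin; rewrite /current_prob.
rewrite -[weight _ (bounded_current f)]/(current_coef (fun=> d) _).
rewrite -[weight _ (subc _ _)]/(current_coef (fun=> d) _).
case: ifP => _; last by rewrite !(mul0r, mulr0).
case: ifP => _; last by rewrite !(mul0r, mulr0).
have -> : 4 ^+ n = 2 ^+ n * 2 ^+ n :> R by rewrite -exprMn -natrM.
rewrite invfM; set t := 2 ^+ n.
have tt : t^-1 * t = 1 by rewrite mulVf// expf_neq0.
transitivity ((t^-1 * t) * (t^-1 * t) * (current_coef (fun=> d) (bounded_current f) /
  fine (Zn lambda S) * (current_coef (fun=> d)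
    (subc (bounded_current g) (bounded_current f)) /
      fine (Zn lambda (finset.set0 : {set 'I_n}))))).
  by rewrite tt !mul1r.
by ring.
Qed.

(** Chernoff's bound with [ch] in place of the exponential, carried out term by term on currents
    bounded by [L], then in the limit. On the event, [ch (s * rho)] times the coefficient at [s = 0]
    is at most the coefficient at [s]. *)
Lemma double_current_tail (x : 'I_n) (s rho : R) : 0 <= s -> 0 <= rho ->
  0 < cw_sum S d -> 0 < cw_sum (finset.set0 : {set 'I_n}) d ->
  (P [set w | (rho <= #|ccluster (Y w) x|%:R)%R] <=
   (cw_overlap S d s / (cw_sum S d * cw_sum (finset.set0 : {set 'I_n}) d)
      / ch (s * rho))%:E)%E.
Proof.
move=> s0 rho0 VS V0.
set Z1 := (fine (Zn lambda S))^-1.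
set Z2 := (fine (Zn lambda (finset.set0 : {set 'I_n})))^-1.
have N1 : Z1 * Zlim S = 1 by exact: current_law_normalization law1.
have N2 : Z2 * Zlim finset.set0 = 1 by exact: current_law_normalization law2.
pose e0 := expR (- (d * n%:R / 2)).
have Zlim_gt0 A : 0 < cw_sum A d -> 0 < Zlim A.
  by move=> VA; rewrite /Zlim !mulr_gt0 ?expR_gt0// invr_gt0 exprn_gt0.
have Z1_gt0 : 0 < Z1 by rewrite -(pmulr_lgt0 _ (Zlim_gt0 _ VS)) N1.
have Z2_gt0 : 0 < Z2 by rewrite -(pmulr_lgt0 _ (Zlim_gt0 _ V0)) N2.
pose Q (m : current n) : bool := rho <= #|ccluster m x|%:R.
have mY := measurable_double_current_fiber.
have c0 : 0 < ch (s * rho) by rewrite (lt_le_trans ltr01)// ch_ge1.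
have lim1 := @cvg_prob_bounded R dT T P n Y Q mY.
have lim2 := @cvg_bounded_double_coef R n lambda S s.
pose K := Z1 * Z2 * (4 ^+ n)^-1 / ch (s * rho).
have lim3 : (fun L => (K * \sum_(f : {ffun edge n -> 'I_L})
    double_coef S d s (bounded_current f))%:E) @ \oo -->
    (K * (expR (- (d * n%:R)) * cw_overlap S d s))%:E.
  by apply: cvg_EFin; [exact: nearW|apply: cvgMr].
have KE : K * (expR (- (d * n%:R)) * cw_overlap S d s) =
    cw_overlap S d s / (cw_sum S d * cw_sum (finset.set0 : {set 'I_n}) d) / ch (s * rho).
  (* Both normalizations are determined by the total mass of the laws; their exponential constant
     cancels the one in front of [cw_overlap]. *)
  have NN : Z1 * Z2 = (4 ^+ n) / (expR (- (d * n%:R)) *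
      (cw_sum S d * cw_sum (finset.set0 : {set 'I_n}) d)).
    have E2 : expR (- (d * n%:R)) = e0 * e0.
      by rewrite /e0 -expRD; congr expR; field.
    have E4 : 4 ^+ n = 2 ^+ n * 2 ^+ n :> R by rewrite -exprMn -natrM.
    apply: (mulIf (lt0r_neq0 (mulr_gt0 (Zlim_gt0 _ VS) (Zlim_gt0 _ V0)))).
    rewrite mulrACA N1 N2 mulr1 E2 E4 /Zlim -/e0; field.
    by rewrite !lt0r_neq0 ?expR_gt0 ?exprn_gt0.
  rewrite /K NN; field.
  by rewrite !lt0r_neq0 ?expR_gt0 ?exprn_gt0.
rewrite -KE -[P _](cvg_lim _ lim1)// -(cvg_lim _ lim3)//.
apply: lee_lim; [exact: cvgP lim1|exact: cvgP lim3|].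
apply: nearW => L /=; rewrite (@prob_bounded R dT T P n Y Q _ mY).
rewrite (eq_bigr _ (fun f _ => double_current_law f)).
rewrite sumEFin lee_fin mulr_sumr big_mkcond/=; apply: ler_sum => f _.
have D0 : 0 <= double_coef S d 0 (bounded_current f).
  rewrite double_coefE mulr_ge0//; first by case: ifP.
  by apply: sumr_ge0 => eta _; rewrite mulr_ge0 ?expR_ge0// agree_coef_ge0// ltW.
have Dch := double_coef_ch_le S s (bounded_current f) x (ltW d_gt0).
have Ds : 0 <= double_coef S d s (bounded_current f).
  by apply: le_trans Dch; rewrite mulr_ge0 ?ch_ge0.
have ZZ : 0 <= Z1 * Z2 * (4 ^+ n)^-1.
  by apply: mulr_ge0; [exact/ltW/mulr_gt0|rewrite invr_ge0 exprn_ge0].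
case: ifPn => Qf; last by rewrite mulr_ge0// mulr_ge0// invr_ge0 ltW.
rewrite /K mulrA -/Z1 -/Z2 -[leRHS]mulrA ler_wpM2l// mulrC ler_pdivlMr// mulrC.
apply: le_trans Dch; rewrite ler_wpM2r//.
by rewrite ler_ch ?mulr_ge0// ler_wpM2l.
Qed.

End DoubleCurrentTail.

(** * Passage to the limit *)

Section CoordinateTails.
Variables (R : realType) (k : nat).

Definition coordinate (i : 'I_(k.*2)) (x : ambient R k) : R := x.1 0 i.

Lemma continuous_coordinate i : continuous (coordinate i).
Proof.
move=> x; apply: (@continuous_comp _ _ _ fst (fun v : 'rV[R]_(k.*2) => v 0 i)).
  exact: cvg_fst.
exact: coord_continuous.
Qed.

Lemma measurable_coordinate (dT : measure_display) (T : measurableType dT)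
    (P : probability T R) (X : {RV P >-> borel (ambient R k)}) i :
  measurable_fun setT (fun w => coordinate i (X w)).
Proof.
apply: (measurability _ (RGenOpens.measurableE R)) => _ [_ [a [b ->]] <-].
have mU : measurable (coordinate i @^-1` `]a, b[%classic : set (borel (ambient R k))).
  apply: sub_sigma_algebra.
  have /continuousP := @continuous_coordinate i; apply; exact: itv_open.
exact: (measurable_funP X measurableT _ mU).
Qed.

(* A continuous function of [y] lying between the indicators of [rho <= y] and
   [rho / 2 <= y]. *)
Definition ramp (rho y : R) : R := Num.min 1 (Num.max 0 (2 * y / rho - 1)).

Lemma ramp_ge0 rho y : 0 <= ramp rho y.
Proof. by rewrite /ramp le_min ler01 le_max lexx. Qed.

Lemma ramp_le1 rho y : ramp rho y <= 1.
Proof. by rewrite /ramp ge_min lexx. Qed.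

Lemma ramp1 rho y : 0 < rho -> rho <= y -> ramp rho y = 1.
Proof.
move=> r0 ry; apply/min_idPl; rewrite le_max; apply/orP; right.
by rewrite lerBrDr ler_pdivlMr//; lra.
Qed.

Lemma ramp0 rho y : 0 < rho -> y < rho / 2 -> ramp rho y = 0.
Proof.
move=> r0 ry; rewrite /ramp max_l ?min_r//.
by rewrite lerBlDr ler_pdivrMr//; lra.
Qed.

Lemma continuous_ramp rho : continuous (ramp rho).
Proof.
have cst (c : R) : continuous ((fun=> c) : R -> R^o) by move=> y; exact: cvg_cst.
have lin : continuous ((fun y => 2 * y / rho - 1) : R -> R^o).
  move=> y; apply: cvgB; last exact: cvg_cst.
  by apply: cvgM; [apply: cvgM; [exact: cvg_cst|exact: cvg_id]|exact: cvg_cst].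
move=> y.
exact: (continuous_min (cst 1 y) (continuous_max (cst 0 y) (lin y))).
Qed.

Variables (disp : nat -> measure_display) (T : forall n, measurableType (disp n)).
Variables (P : forall n, probability (T n) R) (Xn : forall n, T n -> ambient R k).
Variables (dX : measure_display) (TX : measurableType dX) (PX : probability TX R).
Variable X : {RV PX >-> borel (ambient R k)}.
Hypothesis XnX : cvg_in_distribution P Xn PX X.

Lemma cvg_in_distribution_fst :
  cvg_in_distribution P (fun n w => (Xn w).1) PX (fun w => (X w).1).
Proof.
move=> f cf [M fM]; apply: (XnX (f := f \o fst)); last by exists M => x; exact: fM.
by move=> x; apply: continuous_comp; [exact: cvg_fst|exact: cf].
Qed.

Hypothesis measurable_Xn : forall n i,
  measurable_fun setT (fun w : T n => coordinate i (Xn w)).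

(** Convergence in distribution tests continuous functions only; [ramp] replaces the indicator, at
    the cost of halving the threshold. *)
Lemma limit_coordinate_tail i (rho b : R) : 0 < rho ->
  (\forall n \near \oo,
    (P n [set w | (rho / 2 <= coordinate i (Xn w))%R] <= b%:E)%E) ->
  (PX [set w | (rho <= coordinate i (X w))%R] <= b%:E)%E.
Proof.
move=> r0 Pb; pose f (x : ambient R k) : R := ramp rho (coordinate i x).
have mramp : measurable_fun setT (ramp rho).
  by apply: continuous_measurable_fun; exact: continuous_ramp.
have fX : (fun n => 'E_(P n)[f \o @Xn n])%E @ \oo --> ('E_PX[f \o X])%E.
  apply: XnX; last by exists 1 => x; rewrite ger0_norm ?ramp_ge0 ?ramp_le1.
  move=> x; apply: (@continuous_comp _ _ _ (coordinate i) (ramp rho)).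
    exact: continuous_coordinate.
  exact: continuous_ramp.
have mset d' (T' : measurableType d') (Z : T' -> R) c : measurable_fun setT Z ->
    measurable [set w | c <= Z w].
  move=> mZ; rewrite -[X in measurable X]setTI.
  rewrite (_ : [set w | _] = Z @^-1` `[c, +oo[%classic); first exact: mZ.
  by apply/seteqP; split => w /=; rewrite in_itv/= andbT.
have lower : (PX [set w | (rho <= coordinate i (X w))%R] <= 'E_PX[f \o X])%E.
  have mA := mset _ _ _ rho (measurable_coordinate X i).
  rewrite -(setIT [set w | _]) -integral_indic//.
  rewrite -[leLHS]/(\int[PX]_x (\1_[set w | rho <= coordinate i (X w)] x)%:E)%E.
  have mfX : measurable_fun setT (fun w => ramp rho (coordinate i (X w))).
    exact: measurableT_comp mramp (measurable_coordinate X i).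
  rewrite unlock; apply: ge0_le_integral => //.
  - by apply/measurable_EFinP; exact: measurable_indic.
  - by apply/measurable_EFinP; exact: mfX.
  - move=> w _; rewrite lee_fin indicE; case: (boolP (w \in _)) => [|_].
      by rewrite inE /= /f => /(ramp1 r0) ->.
    exact: ramp_ge0.
apply: (le_trans lower); apply: (cvge_to_le fX).
apply: filterS Pb => n; apply: le_trans.
have mA := mset _ _ _ (rho / 2) (@measurable_Xn n i).
rewrite -(setIT [set w | _]) -integral_indic//.
rewrite unlock; apply: ge0_le_integral => //.
- by move=> w _; rewrite lee_fin ramp_ge0.
- by apply/measurable_EFinP; apply: measurableT_comp.
- by apply/measurable_EFinP; exact: measurable_indic.
- move=> w _; rewrite lee_fin indicE; case: (boolP (w \in _)) => [_|].
    exact: ramp_le1.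
  rewrite notin_setE /= => /negP; rewrite -ltNge => h.
  by rewrite /f ramp0.
Qed.

(** If all [N] nonnegative coordinates are below [t / N], the Euclidean norm is below [t]; a union
    bound over coordinates does the rest. *)
Lemma gaussian_tails_of_coordinates (K a : R) : 0 < K -> 0 < a -> (0 < k)%N ->
  (forall w i, 0 <= coordinate i (X w)) ->
  (forall i rho, 0 < rho -> \forall n \near \oo,
    (P n [set w | (rho <= coordinate i (Xn w))%R] <= (K * expR (- a * rho ^+ 2))%:E)%E) ->
  gaussian_tails PX (fun w => (X w).1).
Proof.
move=> K0 a0 k0 X0 tailX; set N : R := k.*2%:R.
have N2 : 2 <= N by rewrite /N ler_nat -muln2 leq_pmull.
have N0 : 0 < N by lra.
(* The first entry is the rate left by the tail at level [t / N / 2]; the second makes [c^-1] at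
   least [N * K], the prefactor of the union bound. *)
pose c := Num.min (a / (4 * N ^+ 2)) (N * K)^-1.
have c0 : 0 < c.
  by rewrite lt_min divr_gt0 ?mulr_gt0 ?exprn_gt0//= invr_gt0 mulr_gt0.
exists c => // t t1; pose rho := t / N.
have t0 : 0 < t by lra.
have rho0 : 0 < rho by rewrite divr_gt0.
pose B i := [set w | rho <= coordinate i (X w)].
have mB i : measurable (B i).
  rewrite -[B i]setTI (_ : B i = (fun w => coordinate i (X w)) @^-1` `[rho, +oo[%classic).
    exact: measurable_coordinate.
  by apply/seteqP; split => w; rewrite /B/= in_itv/= andbT.
have PB i : (PX (B i) <= (K * expR (- a * (rho / 2) ^+ 2))%:E)%E.
  by apply: limit_coordinate_tail => //; apply: tailX; rewrite divr_gt0.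
pose A j := if (insub j : option 'I_(k.*2)) is Some i then B i else set0.
have mA j : measurable (A j) by rewrite /A; case: insub.
have msum : measurable_fun setT (fun w => \sum_i (coordinate i (X w)) ^+ 2).
  by apply: measurable_sum => i; apply: measurable_funX; exact: measurable_coordinate.
have mC : measurable [set w | t <= euclidean_norm (X w).1].
  rewrite -[X in measurable X]setTI (_ : [set w | _] =
    (fun w => \sum_i (coordinate i (X w)) ^+ 2) @^-1` `[t ^+ 2, +oo[%classic).
    exact: msum.
  apply/seteqP; split => w; rewrite /= in_itv/= andbT /euclidean_norm => h.
    rewrite -[leRHS]sqr_sqrtr ?lerXn2r ?nnegrE ?sqrtr_ge0 ?(ltW t0)//.
    by apply: sumr_ge0 => i _; exact: sqr_ge0.
  by rewrite -(ger0_norm (ltW t0)) -sqrtr_sqr ler_wsqrtr.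
have sub : [set w | t <= euclidean_norm (X w).1] `<=` \big[setU/set0]_(j < k.*2) A j.
  move=> w /= tX; rewrite -bigcup_mkord; apply: contrapT => nB.
  have ltr i : coordinate i (X w) < rho.
    rewrite ltNge; apply/negP => Bi; apply: nB; exists (val i) => //=.
    by rewrite /A valK.
  suff : euclidean_norm (X w).1 < t by rewrite ltNge tX.
  rewrite -(ger0_norm (ltW t0)) -sqrtr_sqr ltr_sqrt ?exprn_gt0//.
  apply: (@le_lt_trans _ _ (\sum_(i < k.*2) rho ^+ 2)).
    by apply: ler_sum => i _; rewrite lerXn2r ?nnegrE ?(ltW rho0) ?(ltW (ltr i))//; exact: X0.
  rewrite sumr_const card_ord -mulr_natl -/N /rho expr_div_n.
  rewrite mulrCA -[ltRHS]mulr1 ltr_pM2l ?exprn_gt0//.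
  by rewrite ltr_pdivrMr ?exprn_gt0// mul1r; nra.
apply: (le_trans (le_measure _ _ _ sub)); rewrite ?inE//.
  by apply: bigsetU_measurable => j _.
apply: (le_trans (Boole_inequality PX (fun j _ => mA j))).
apply: (@le_trans _ _ (\sum_(j < k.*2) (K * expR (- a * (rho / 2) ^+ 2))%:E)%E).
  by apply: lee_sum => j _; have := PB j; rewrite /A (valK j).
rewrite sumEFin lee_fin sumr_const card_ord -[leLHS]mulr_natl -/N (mulrA N) ler_pM//.
- by rewrite mulr_ge0// ltW.
- by rewrite -[leLHS]invrK lef_pV2 ?posrE ?invr_gt0 ?mulr_gt0// ge_min lexx orbT.
rewrite ler_expR !mulNr lerN2.
have -> : a * (rho / 2) ^+ 2 = a / (4 * N ^+ 2) * t ^+ 2.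
  by rewrite /rho; field; rewrite gt_eqF.
by rewrite ler_wpM2r ?sqr_ge0// ge_min lexx.
Qed.

End CoordinateTails.

(** * Uniform cluster tails and the conclusion *)

Lemma card_Sn (k n : nat) : (k.*2 <= n)%N -> #|Sn k n| = k.*2.
Proof.
move=> kn; have winj : injective (widen_ord kn).
  by move=> x y /(congr1 (@nat_of_ord n)) /= /val_inj.
rewrite -[RHS]card_ord -(card_imset _ winj).
apply: eq_card => x; rewrite inE; apply/idP/imsetP => [xk|[y _ ->]].
  by exists (Ordinal xk) => //; exact: val_inj.
exact: (ltn_ord y).
Qed.

Lemma dn_gt0 (R : realType) (lambda : R) :
  \forall n \near \oo, 0 < dn n lambda.
Proof.
have [N rN] := ex_sqrt_natr_ge (`|lambda| + 1).
exists N => //= n Nn; have r1 := rN n Nn.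
have l0 := normr_ge0 lambda; have l1 := ler_norm lambda.
have r0 : 0 < Num.sqrt n%:R :> R by lra.
have n0 : 0 < n%:R :> R by rewrite -sqrtr_gt0.
by rewrite /dn mulr_gt0 ?invr_gt0// subr_gt0 ltr_pdivrMr// mul1r; lra.
Qed.

Lemma ccluster_addc (n : nat) (m1 m2 : current n) (x : nat) :
  ccluster m1 x \subset ccluster (addc m1 m2) x.
Proof.
apply/fintype.subsetP => y; rewrite !inE => /existsP[i /existsP[j /and3P[ix jy ij]]].
apply/existsP; exists i; apply/existsP; exists j; rewrite ix jy /=.
apply: connect_sub ij => a b /existsP[e /andP[ab m1e]]; apply: connect1.
by apply/existsP; exists e; rewrite ab ffunE addn_gt0 m1e.
Qed.

(** The constants serve all levels [rho], while the rank from which the bound holds may depend on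
    [rho]; this is enough for the limit. *)
Lemma gaussian_tails_of_currents (R : realType) (lambda : R) (k : nat)
    (d : nat -> measure_display) (T : forall n, measurableType (d n))
    (P : forall n, probability (T n) R)
    (n1 n2 : forall n, {RV (P n) >-> current n})
    (n1_law : forall n, 0 < dn n lambda -> (k.*2 <= n)%N ->
      forall m : current n,
        P n (n1 n @^-1` [set m]) = (current_prob lambda (Sn k n) m)%:E)
    (n2_law : forall n, 0 < dn n lambda -> (k.*2 <= n)%N ->
      forall m : current n,
        P n (n2 n @^-1` [set m]) = (current_prob lambda finset.set0 m)%:E)
    (n1_n2_indep : forall n, 0 < dn n lambda -> (k.*2 <= n)%N ->
      independent_RV (P n) (n1 n) (n2 n)) :
  exists K a : R, [/\ 0 < K, 0 < a & forall (i : 'I_(k.*2)) (rho : R), 0 < rho ->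
    \forall n \near \oo,
      (P n [set w | (rho <= coordinate i (cluster_data R k (addc (n1 n w) (n2 n w))))%R]
        <= (K * expR (- a * rho ^+ 2))%:E)%E].
Proof.
have [K K0 ratio] := cw_overlap_ratio_le lambda k.
(* The 2 comes from [expR y <= 2 * ch y]. The maximum over [h] of [h * rho - 101 * h ^+ 2] is
   [rho ^+ 2 / 404], attained at [h = rho / 202]. *)
exists (2 * K), 404^-1; split; [exact: mulr_gt0|by rewrite invr_gt0 ltr0n|].
move=> i rho rho0; pose h := rho / 202.
have h0 : 0 <= h by rewrite divr_ge0// ltW.
have [N ratioN] := ratio h h0.
near=> n.
have kn : (k.*2 <= n)%N by near: n; exists k.*2.
have Nn : (N <= n)%N by near: n; exists N.
have n_gt0 : (0 < n)%N by near: n; exists 1%N.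
have dn0 : 0 < dn n lambda by near: n; exact: dn_gt0.
have [VS V0 U] := ratioN n Nn (Sn k n) (card_Sn kn).
set r := Num.sqrt n%:R in U.
have r0 : 0 < r by rewrite sqrtr_gt0 ltr0n.
have := @double_current_tail R _ _ (P n) n lambda (Sn k n) dn0 (n1 n) (n2 n)
  (n1_law n dn0 kn) (n2_law n dn0 kn) (n1_n2_indep n dn0 kn) (widen_ord kn i)
  (h / r) (rho * r).
move=> /(_ _ _ VS V0); rewrite divr_ge0 ?mulr_ge0 ?(ltW r0) ?(ltW rho0)//.
move=> /(_ isT isT) tail.
have -> : [set w | (rho <= coordinate i (cluster_data R k (addc (n1 n w) (n2 n w))))%R] =
    [set w | (rho * r <= #|ccluster (addc (n1 n w) (n2 n w)) (widen_ord kn i)|%:R)%R].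
  by apply/seteqP; split => w; rewrite /= /coordinate /= mxE ler_pdivlMr.
apply: (le_trans tail); rewrite lee_fin.
have -> : h / r * (rho * r) = h * rho by field; rewrite gt_eqF.
have c0 : 0 < ch (h * rho) by rewrite (lt_le_trans ltr01)// ch_ge1.
rewrite ler_pdivrMr// ler_pdivrMr ?mulr_gt0//.
apply: (le_trans U); rewrite ler_wpM2r ?mulr_ge0 ?(ltW VS) ?(ltW V0)//.
have chE : expR (h * rho) <= 2 * ch (h * rho).
  by rewrite /ch; have := expR_gt0 (- (h * rho)); lra.
apply: (@le_trans _ _ (K * expR (- 404^-1 * rho ^+ 2) * expR (h * rho))).
  rewrite -!mulrA ler_wpM2l ?(ltW K0)// -expRD ler_expR /h.
  by rewrite le_eqVlt; apply/orP; left; apply/eqP; field.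
have -> : 2 * K * expR (- 404^-1 * rho ^+ 2) * ch (h * rho) =
  K * expR (- 404^-1 * rho ^+ 2) * (2 * ch (h * rho)) by ring.
apply: ler_wpM2l chE; apply: mulr_ge0; [exact: ltW|exact: expR_ge0].
Unshelve. all: by end_near.
Qed.

Theorem corollary1p3 (R : realType) (lambda : R) (k : nat) (k_ge1 : (1 <= k)%N)
  (d : nat -> measure_display) (T : forall n, measurableType (d n))
  (P : forall n, probability (T n) R)
  (n1 n2 : forall n, {RV (P n) >-> current n})
  (n1_law : forall n, 0 < dn n lambda -> (k.*2 <= n)%N ->
    forall m : current n,
      P n (n1 n @^-1` [set m]) = (current_prob lambda (Sn k n) m)%:E)
  (n2_law : forall n, 0 < dn n lambda -> (k.*2 <= n)%N ->
    forall m : current n,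
      P n (n2 n @^-1` [set m]) = (current_prob lambda finset.set0 m)%:E)
  (n1_n2_indep : forall n, 0 < dn n lambda -> (k.*2 <= n)%N ->
    independent_RV (P n) (n1 n) (n2 n))
  (ds : measure_display) (Ts : measurableType ds) (Ps : probability Ts R)
  (Xs : {RV Ps >-> borel (ambient R k)})
  (Xs_state : forall w, state_space (Xs w))
  (Xs_lim : cvg_in_distribution P
    (fun n w => cluster_data R k (n1 n w)) Ps Xs)
  (dd : measure_display) (Td : measurableType dd) (Pd : probability Td R)
  (Xd : {RV Pd >-> borel (ambient R k)})
  (Xd_state : forall w, state_space (Xd w))
  (Xd_lim : cvg_in_distribution P
    (fun n w => cluster_data R k (addc (n1 n w) (n2 n w))) Pd Xd) :
  let Ys : Ts -> 'rV[R]_(k.*2) := fun w => (Xs w).1 in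
  let Yd : Td -> 'rV[R]_(k.*2) := fun w => (Xd w).1 in
  [/\ gaussian_tails Ps Ys,
      gaussian_tails Pd Yd,
      cvg_in_distribution P (fun n w => cluster_vector R k (n1 n w)) Ps Ys
    & cvg_in_distribution P
        (fun n w => cluster_vector R k (addc (n1 n w) (n2 n w))) Pd Yd].
Proof.
move=> Ys Yd.
have [K [a [K0 a0 tail]]] := gaussian_tails_of_currents n1_law n2_law n1_n2_indep.
have m1 n m : measurable (n1 n @^-1` [set m]) by exact: measurable_current_fiber.
have m12 n m : measurable ((fun w => addc (n1 n w) (n2 n w)) @^-1` [set m]).
  exact: measurable_double_current_fiber.
have meas n (Y : T n -> current n) i : (forall m, measurable (Y @^-1` [set m])) ->
    measurable_fun setT (fun w => coordinate i (cluster_data R k (Y w))).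
  move=> mY _ B _; rewrite setTI.
  have := @measurable_current_event _ _ n Y
    (fun m => `[< B (coordinate i (cluster_data R k m)) >]) mY.
  congr (measurable _); apply/seteqP; split => w /=; first by move=> /asboolP.
  by move=> Bw; apply/asboolP.
have state (x : ambient R k) i : state_space x -> 0 <= coordinate i x.
  by move=> [x0 _]; exact: x0.
split; [| |exact: cvg_in_distribution_fst Xs_lim|exact: cvg_in_distribution_fst Xd_lim].
- apply: (@gaussian_tails_of_coordinates R k d T P
    (fun n w => cluster_data R k (n1 n w)) ds Ts Ps Xs Xs_lim _ K a K0 a0 k_ge1).
  + by move=> n i; exact: meas.
  + by move=> w i; exact: state (Xs_state w).
  (* Clusters of the first current lie inside those of the sum, so the double-current constants also
     serve here. *)
  + move=> i rho rho0; apply: filterS (tail i rho rho0) => n; apply: le_trans.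
    have mset (Y : T n -> current n) : (forall m, measurable (Y @^-1` [set m])) ->
        measurable [set w | (rho <= coordinate i (cluster_data R k (Y w)))%R].
      exact: (@measurable_current_event _ _ n Y
        (fun m => rho <= coordinate i (cluster_data R k m))).
    apply: le_measure; rewrite ?inE; [exact: mset|exact: mset|].
    move=> w /= /le_trans; apply; rewrite /coordinate /= !mxE.
    by rewrite ler_wpM2r ?invr_ge0 ?sqrtr_ge0// ler_nat subset_leq_card// ccluster_addc.
- apply: (@gaussian_tails_of_coordinates R k d T P
    (fun n w => cluster_data R k (addc (n1 n w) (n2 n w))) dd Td Pd Xd Xd_lim
    _ K a K0 a0 k_ge1).
  + by move=> n i; exact: meas.
  + by move=> w i; exact: state (Xd_state w).
  + exact tail.
Qed.
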